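(* Let $k_1<k_2$, $\lambda_1$, $\lambda_2$ be positive integers with $\lambda_1k_2(k_2-1)=\lambda_2k_1(k_1-1)$. Then there exists an integer $v_0$ such that for every $v\geq v_0$ satisfying $\lambda_1(v-1)\equiv 0\pmod{k_1-1}$, $\lambda_1 v(v-1)\equiv 0\pmod{k_1(k_1-1)}$ and $\lambda_2(v-1)\equiv 0\pmod{k_2-1}$, there exists a $(k_2,\lambda_2;k_1,\lambda_1)$-nesting on $v$ points.
   Context: A $(v,k,\lambda)$-BIBD is a pair $(X,\mathcal{B})$ with $|X|=v$ and $\mathcal{B}$ a (multi)set of $k$-subsets of $X$ (blocks) such that every pair of distinct points lies in exactly $\lambda$ blocks. For $k_1<k_2$, a $(k_2,\lambda_2;k_1,\lambda_1)$-nesting on $v$ points is a $(v,k_2,\lambda_2)$-BIBD $(X,\mathcal{B})$ together with, for each block $B\in\mathcal{B}$, a distinguished subset $B'\subseteq B$ with $|B'|=k_1$, such that $(X,\{B'\mid B\in\mathcal{B}\})$ is a $(v,k_1,\lambda_1)$-BIBD. *)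

(* Defs.v *)
From mathcomp Require Import all_boot.

Set Implicit Arguments.
Unset Strict Implicit.
Unset Printing Implicit Defensive.

(* A multiset of blocks is a family [B : I -> {set X}] over a finite type [I]:
   the indices are the block occurrences, so repeated blocks are allowed and
   counting indices counts blocks with multiplicity. *)
Definition is_BIBD (v k lambda : nat) (X I : finType) (B : I -> {set X}) : Prop :=
  [/\ #|X| = v,
      forall i : I, #|B i| = k
    & forall x y : X, x != y ->
        #|[set i : I | (x \in B i) && (y \in B i)]| = lambda].

(* [B' i] is the subset distinguished in the block occurrence [B i]; equal
   blocks at different indices may have different distinguished subsets. *)
Definition is_nesting (v k2 lambda2 k1 lambda1 : nat) (X I : finType)
    (B B' : I -> {set X}) : Prop :=
  [/\ is_BIBD v k2 lambda2 B,
      forall i : I, B' i \subset B i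
    & is_BIBD v k1 lambda1 B'].

Definition has_nesting (k2 lambda2 k1 lambda1 v : nat) : Prop :=
  exists (X I : finType) (B B' : I -> {set X}),
    is_nesting v k2 lambda2 k1 lambda1 B B'.

(* Main.v *)
Require Import Defs.
From HB Require Import structures.
From mathcomp Require Import all_boot all_order all_fingroup all_algebra all_field.
From mathcomp Require Import cyclic zify ring boolp.

Set Implicit Arguments.
Unset Strict Implicit.
Unset Printing Implicit Defensive.

Import GRing.Theory Num.Theory Order.TTheory.

(** Nestings are an instance of Wilson's existence theory for decompositions of complete
    graphs into coloured cliques.  Record a nested block as an injection of [k2] positions into
    the point set, and colour a pair of positions by whether both lie among the first
    [k1]: a nesting is a decomposition of the complete graph, taken with multiplicity
    [lambda1] in one colour and [lambda2 - lambda1] in the other, into copies of one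
    two-coloured clique.  For any colouring of the pairs of [k] positions:

    - Finite fields: if the multiplicities are [l / e] times the numbers of pairs of
      positions of each colour and [q] is a large prime power with [q = 1] modulo [2 e],
      base blocks whose differences lie in prescribed cyclotomic classes exist by a
      second moment argument; developing them gives a design on [q] points.

    - Large index to index one: on a complete multipartite graph satisfying the
      divisibility conditions the multiplicities are an integral combination of
      blocks; adding copies of the family of all blocks makes the coefficients
      nonnegative, at the price of multiplying the multiplicities by any large
      [q].  When [q] is the order of a field this factor is absorbed by
      replacing each point by a vector space over the field.

    - Closure: transversal designs combine these ingredients.  They yield [D] such
      that group divisible designs with [m] groups of size [D] and designs on
      [m D + 1] points exist for all [m >= k + 4]; then, for an admissible residue
      class, [k + 4] groups of size [w m D] with a common hole of size [w], and one
      more group carrying the right residue, reach every large admissible [v]. *)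

(** * Decompositions into coloured cliques *)

Lemma exists_injection (X Y : finType) : #|X| <= #|Y| -> exists f : X -> Y, injective f.
Proof.
move=> XY; exists (fun x => enum_val (widen_ord XY (enum_rank x))) => x y.
by move=> /enum_val_inj/(congr1 val)/= /val_inj/enum_rank_inj.
Qed.

Lemma card_preim_fst (A B : finType) (Q : pred A) :
  #|[pred x : A * B | Q x.1]| = #|[pred a | Q a]| * #|B|.
Proof. by rewrite -cardX; apply: eq_card => x; rewrite !inE andbT. Qed.

Lemma card_fst_fiber (A B : finType) (a : A) : #|[pred x : A * B | x.1 == a]| = #|B|.
Proof. by rewrite (@card_preim_fst _ B (pred1 a)) card1 mul1n. Qed.

Section Decomposition.
Variables (k : nat) (C : finType) (col : 'I_k -> 'I_k -> C) (mu : C -> nat).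

Definition col_pairs c : pred ('I_k * 'I_k) :=
  [pred p | (p.1 != p.2) && (col p.1 p.2 == c)].

Definition edge_mult (X : eqType) (b : 'I_k -> X) c x y : nat :=
  \sum_(p in col_pairs c) ((b p.1 == x) && (b p.2 == y)).

(* The diagonal is included: when [r] is irreflexive this forces every [b i] to
   be injective, see [blocks_inj]. *)
Definition decomposable (X : finType) (r : rel X) : Prop :=
  exists (I : finType) (b : I -> 'I_k -> X),
    forall c x y, \sum_i edge_mult (b i) c x y = mu c * r x y.

Lemma edge_mult_comp_inj (X Y : eqType) (e : Y -> X) (b : 'I_k -> Y) c x y :
  injective e -> edge_mult (e \o b) c (e x) (e y) = edge_mult b c x y.
Proof. by move=> eI; apply: eq_bigr => p _; rewrite /= !(inj_eq eI). Qed.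

Lemma blocks_inj (X I : finType) (b : I -> 'I_k -> X) (n : C -> nat) (r : rel X) :
  irreflexive r -> (forall c x y, \sum_i edge_mult (b i) c x y = n c * r x y) ->
  forall i, injective (b i).
Proof.
move=> r_irr bE i p q bpq; apply/eqP; apply: contraT => npq.
have := bE (col p q) (b i p) (b i p); rewrite r_irr muln0 (bigD1 i) //= /edge_mult.
by rewrite (bigD1 (p, q)) /=; rewrite ?inE /= ?npq ?eqxx // bpq eqxx.
Qed.

Lemma decomposable_eq (X : finType) (r r' : rel X) :
  r =2 r' -> decomposable r -> decomposable r'.
Proof. by move=> rr' [I [b bE]]; exists I, b => c x y; rewrite bE rr'. Qed.

Lemma decomposable_sum (X J : finType) (rJ : J -> rel X) (r : rel X) :
  (forall j, decomposable (rJ j)) -> (forall x y, \sum_j rJ j x y = r x y) ->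
  decomposable r.
Proof.
move=> rJ_dec rE.
have /choice [S SE] : forall j, exists S : {I : finType & I -> 'I_k -> X},
    forall c x y, \sum_i edge_mult (tagged S i) c x y = mu c * rJ j x y.
  by move=> j; have [I [b bE]] := rJ_dec j; exists (Tagged _ b).
exists {j : J & tag (S j)}, (fun i => tagged (S (tag i)) (tagged i)) => c x y.
rewrite -rE big_distrr /=; under [RHS]eq_bigr do rewrite -SE.
by rewrite (sig_big_dep xpredT (fun _ => xpredT)
  (fun j i => edge_mult (tagged (S j) i) c x y)).
Qed.

Lemma decomposable_classes (X J : finType) (cl : X -> X -> J) (r : rel X) :
  (forall j, decomposable (fun x y => (cl x y == j) && r x y)) -> decomposable r.
Proof.
move/decomposable_sum; apply=> x y; rewrite (bigD1 (cl x y)) //= eqxx big1 ?addn0 // => j.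
by rewrite eq_sym => /negbTE ->.
Qed.

Lemma decomposable_embed (X Y : finType) (e : Y -> X) (rX : rel X) (rY : rel Y) :
  injective e -> (forall a b, rX (e a) (e b) = rY a b) ->
  (forall x y, rX x y -> (x \in codom e) && (y \in codom e)) ->
  decomposable rY -> decomposable rX.
Proof.
move=> eI rE rX_codom [I [b bE]]; exists I, (fun i => e \o b i) => c x y.
have [/andP[/codomP[a ->] /codomP[a' ->]]|xy_out] :=
    boolP ((x \in codom e) && (y \in codom e)).
  by rewrite rE -bE; apply: eq_bigr => i _; apply: edge_mult_comp_inj.
have -> : rX x y = false by apply: contraNF xy_out; apply: rX_codom.
rewrite muln0; apply: big1 => i _; apply: big1 => p _; apply/eqP.
by rewrite eqb0 /=; apply: contra xy_out => /andP[/eqP <- /eqP <-]; rewrite !codom_f.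
Qed.

Lemma decomposable_iso (X Y : finType) (f : Y -> X) (rX : rel X) (rY : rel Y) :
  bijective f -> (forall a b, rX (f a) (f b) = rY a b) ->
  decomposable rY <-> decomposable rX.
Proof.
move=> [g fK gK] rE; split.
  apply: (decomposable_embed (can_inj fK) rE) => x y _.
  by rewrite -[x]gK -[y]gK !codom_f.
apply: (decomposable_embed (can_inj gK)) => [a b|x y _]; first by rewrite -rE !gK.
by rewrite -[x]fK -[y]fK !codom_f.
Qed.

Definition has_design v := decomposable (fun x y : 'I_v => x != y).

Definition has_GDD g m := decomposable (fun x y : 'I_m * 'I_g => x.1 != y.1).

Definition hole_rel (Z H : eqType) : rel (Z + H) :=
  fun x y => if (x, y) is (inr _, inr _) then false else x != y.

Definition has_holey_design u n := decomposable (@hole_rel 'I_u 'I_n).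

Lemma has_design_card (X : finType) v : #|X| = v ->
  has_design v <-> decomposable (fun x y : X => x != y).
Proof.
move=> <-; apply: (decomposable_iso (f := enum_val)); first exact: enum_val_bij.
by move=> x y; rewrite (inj_eq enum_val_inj).
Qed.

Lemma has_GDD_card (P U : finType) g m : #|U| = g -> #|P| = m ->
  has_GDD g m <-> decomposable (fun x y : P * U => x.1 != y.1).
Proof.
move=> <- <-; apply: (@decomposable_iso _ _ (fun a => (enum_val a.1, enum_val a.2))).
  by exists (fun a => (enum_rank a.1, enum_rank a.2)) => -[p u];
    rewrite /= ?enum_valK ?enum_rankK.
by move=> x y; rewrite (inj_eq enum_val_inj).
Qed.

Lemma has_GDD_assoc (P U1 U2 : finType) g m : #|U1| * #|U2| = g -> #|P| = m ->
  decomposable (fun x y : P * U1 * U2 => x.1.1 != y.1.1) -> has_GDD g m.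
Proof.
move=> cU cP dec; apply/(has_GDD_card (P := P) (U := (U1 * U2)%type)); rewrite ?card_prod //.
have assoc_bij : bijective (fun a : P * U1 * U2 => (a.1.1, (a.1.2, a.2))).
  by exists (fun a => ((a.1, a.2.1), a.2.2)) => [[[]]|[? []]].
exact/(decomposable_iso (rX := fun a b => a.1 != b.1) assoc_bij).
Qed.

Lemma has_holey_design_card (Z H : finType) u n : #|Z| = u -> #|H| = n ->
  has_holey_design u n <-> decomposable (@hole_rel Z H).
Proof.
move=> <- <-; pose f (a : 'I_#|Z| + 'I_#|H|) : Z + H :=
  match a with inl z => inl (enum_val z) | inr h => inr (enum_val h) end.
pose g (a : Z + H) : 'I_#|Z| + 'I_#|H| :=
  match a with inl z => inl (enum_rank z) | inr h => inr (enum_rank h) end.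
have fK : cancel f g by case=> z; rewrite /= enum_valK.
apply: (@decomposable_iso _ _ f).
  by exists g => // -[z|h]; rewrite /= enum_rankK.
by move=> x y; rewrite /hole_rel (inj_eq (can_inj fK)); case: x y => [z|h] [z'|h'].
Qed.

Lemma has_GDD1 m : has_GDD 1 m <-> has_design m.
Proof.
symmetry; apply: (@decomposable_iso _ _ (fun a : 'I_m => (a, ord0))) => //.
by exists fst => // -[a u]; rewrite [u]ord1.
Qed.

Lemma has_holey_design_le1 u n : n <= 1 -> has_holey_design u n <-> has_design (u + n).
Proof.
move=> n_le1; rewrite (has_design_card (X := ('I_u + 'I_n)%type)) ?card_sum ?card_ord //.
have hole_neq : @hole_rel 'I_u 'I_n =2 (fun x y => x != y).
  move=> [z|h] [z'|h'] //=; case: n n_le1 h h' => [|[|//]] _ h h'; first by case: h.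
  by rewrite !ord1 eqxx.
by split; apply: decomposable_eq => // x y; rewrite hole_neq.
Qed.

Section Filling.
Variables (P J H : finType) (grp : P -> J) (j0 : J).

(* [None] collects the pairs of distinct groups; the pairs of the hole go to [j0]. *)
Let fill_class (x y : P + H) : option J := match x, y with
  | inl x, inl y => if grp x == grp y then Some (grp x) else None
  | inl x, inr _ | inr _, inl x => Some (grp x)
  | inr _, inr _ => Some j0 end.

Let part j := {x | grp x == j}.

Let part_embed j (x : part j + H) : P + H :=
  match x with inl z => inl (val z) | inr h => inr h end.

Let part_embed_inj j : injective (@part_embed j).
Proof. by move=> [z|h] [z'|h'] //= [] => [/val_inj|] ->. Qed.

Let fill_class_embed j a b : fill_class (@part_embed j a) (@part_embed j b) =
  Some (if (a, b) is (inr _, inr _) then j0 else j).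
Proof. by case: a b => [[z /= /eqP zj]|h] [[z' /= /eqP z'j]|h'] //=; rewrite ?zj ?z'j ?eqxx. Qed.

Let codom_part_embed j x y : fill_class x y = Some j ->
  (x \in codom (@part_embed j)) && (y \in codom (@part_embed j)).
Proof.
have inl_codom z : grp z = j -> inl z \in codom (@part_embed j).
  by move/eqP => zj; apply/codomP; exists (inl (exist _ z zj)).
have inr_codom h : inr h \in codom (@part_embed j) by apply/codomP; exists (inr h).
case: x y => [z|h] [z'|h'] /=; rewrite ?inr_codom ?andbT //.
- by case: eqP => // zz' [zj]; rewrite !inl_codom // -zz'.
- by case=> zj; rewrite inl_codom.
- by case=> zj; rewrite inl_codom.
Qed.

Let decomposable_class j (r : rel (part j + H)) :
  (forall a b, r a b = (fill_class (part_embed a) (part_embed b) == Some j) && (a != b)) ->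
  decomposable r -> decomposable (fun x y => (fill_class x y == Some j) && (x != y)).
Proof.
move=> rE; apply: (decomposable_embed (@part_embed_inj j)) => [a b|x y].
  by rewrite rE (inj_eq (@part_embed_inj j)).
by move=> /andP[/eqP xy _]; apply: codom_part_embed.
Qed.

Lemma decomposable_fill :
  decomposable (fun x y => grp x != grp y) ->
  (forall j, j != j0 -> has_holey_design #|[pred x | grp x == j]| #|H|) ->
  has_design (#|[pred x | grp x == j0]| + #|H|) ->
  decomposable (fun x y : P + H => x != y).
Proof.
move=> cross_dec holey_dec fill_dec; apply: (@decomposable_classes _ _ fill_class) => -[j|].
  have card_part : #|{: part j}| = #|[pred x | grp x == j]| by rewrite card_sig.
  have [jj0|nj] := eqVneq j j0.
    move: fill_dec; rewrite -jj0 -card_part -card_sum => /(has_design_card (erefl _)).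
    apply: decomposable_class => a b.
    by rewrite fill_class_embed -jj0; case: a b => [?|?] [?|?]; rewrite eqxx.
  move: (holey_dec j nj); rewrite -card_part => /(has_holey_design_card (erefl _) (erefl _)).
  apply: decomposable_class => a b; rewrite fill_class_embed (inj_eq Some_inj) /hole_rel.
  by case: a b => [?|?] [?|?]; rewrite ?eqxx // eq_sym (negbTE nj).
apply: (@decomposable_embed _ _ inl _ _ _ _ _ cross_dec); first by move=> ? ? [].
  by move=> x y /=; case: ifPn => //= xy; apply: contraNneq xy => -[->].
by move=> [x|h] [y|h'] //=; rewrite !codom_f.
Qed.

End Filling.

Lemma has_design_fill_groups g m n : n <= 1 -> 0 < m ->
  has_GDD g m -> has_design (g + n) -> has_design (m * g + n).
Proof.
move=> n_le1 m_gt0 gdd fill.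
rewrite (has_design_card (X := ('I_m * 'I_g + 'I_n)%type)); last first.
  by rewrite card_sum card_prod !card_ord.
apply: (@decomposable_fill _ _ _ fst (Ordinal m_gt0)) => // [j _|];
  by rewrite card_fst_fiber !card_ord // has_holey_design_le1.
Qed.

End Decomposition.

(** * Dividing the index by the order of a field *)

Lemma uniform_coloring (A C : finType) (c0 : C) (P : {set A}) n :
  #|P| = #|C| * n -> exists f : A -> C, forall c, #|[set a in P | f a == c]| = n.
Proof.
move=> cP; have cCn : #|{: C * 'I_n}| = #|P| by rewrite card_prod card_ord cP.
pose g (x : C * 'I_n) : A := enum_val (cast_ord cCn (enum_rank x)).
have g_inj : injective g by move=> x y /enum_val_inj/cast_ord_inj/enum_rank_inj.
have g_onto a : a \in P -> exists x, g x = a.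
  move=> aP; exists (enum_val (cast_ord (esym cCn) (enum_rank_in aP a))).
  by rewrite /g enum_valK cast_ordKV enum_rankK_in.
pose f a := if [pick x | g x == a] is Some x then x.1 else c0.
have fg x : f (g x) = x.1.
  by rewrite /f; case: pickP => [y /eqP/g_inj -> //|/(_ x)]; rewrite eqxx.
exists f => c; rewrite -[RHS]card_ord -(@card_imset _ _ (fun i => g (c, i))); last first.
  by move=> i j /g_inj [].
apply: eq_card => a; rewrite inE; apply/andP/imsetP => [[aP /eqP <-]|[i _ ->]].
  by have [[c' i] <-] := g_onto a aP; exists i; rewrite // fg.
by rewrite fg; split=> //; apply: enum_valP.
Qed.

Section Lines.
Local Open Scope ring_scope.
Variables (F : fieldType) (K : finType).
Local Notation U := {ffun K -> F}.

Definition line (a slope : K -> F) (s t : U) : U := [ffun q => a q + s q + slope q * t q].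

Lemma line_through (a a' d d' : K -> F) (u u' s t : U) : (forall q, d q != d' q) ->
  ((line a d s t == u) && (line a' d' s t == u')) =
  ((t == [ffun q => ((u q - u' q) - (a q - a' q)) / (d q - d' q)]) &&
   (s == [ffun q => u q - a q - d q * t q])).
Proof.
move=> dd'; have {}dd' q : d q - d' q != 0 by rewrite subr_eq0.
apply/andP/andP => -[/eqP/ffunP eq1 /eqP/ffunP eq2]; split; apply/eqP/ffunP => q.
- rewrite !ffunE -eq1 -eq2 !ffunE; apply: (mulIf (dd' q)); rewrite mulfVK //; ring.
- by rewrite !ffunE -eq1 !ffunE; ring.
- by rewrite !ffunE eq2 !ffunE; ring.
- by rewrite !ffunE eq2 !ffunE eq1 !ffunE; field.
Qed.
End Lines.

Section NullSumLines.
Local Open Scope ring_scope.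
Variables (F : finFieldType) (K : finType).
Local Notation U := {ffun K -> F}.

Definition null_sum : pred U := [pred t : U | \sum_q t q == 0].

Lemma count_lines_through (a a' d d' : K -> F) (u u' : U) : (forall q, d q != d' q) ->
  (\sum_(st : U * {t | null_sum t})
     ((line a d st.1 (val st.2) == u) && (line a' d' st.1 (val st.2) == u')) =
   (\sum_q (a q - a' q) / (d q - d' q) == \sum_q (u q - u' q) / (d q - d' q))%R)%N.
Proof.
move=> dd'; pose t0 : U := [ffun q => ((u q - u' q) - (a q - a' q)) / (d q - d' q)].
pose s0 : U := [ffun q => u q - a q - d q * t0 q].
have sum_t0 : \sum_q t0 q =
    \sum_q (u q - u' q) / (d q - d' q) - \sum_q (a q - a' q) / (d q - d' q).
  by rewrite -sumrB; apply: eq_bigr => q _; rewrite ffunE mulrBl.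
rewrite eq_sym -subr_eq0 -sum_t0; under eq_bigr do rewrite (line_through _ _ _ _ _ _ dd').
have [t0_null|t0_null] := boolP (\sum_q t0 q == 0).
  rewrite (bigD1 (s0, Sub t0 t0_null)) //= !eqxx big1 // => -[s t] /=.
  by rewrite xpair_eqE -val_eqE /=; case: (sval t =P t0) => //= ->; rewrite andbT => /negbTE ->.
apply: big1 => -[s t] _ /=; case: eqP => //= t_t0.
by have := valP t; rewrite /null_sum /= t_t0 (negbTE t0_null).
Qed.
End NullSumLines.

Section Slopes.
Local Open Scope ring_scope.
Variables (V : finType) (F : fieldType) (K : finType).
Variables (coord : option V -> K) (value : option V -> F).
Hypotheses (coord_inj : injective coord) (value_inj : injective value).

Definition slope x q : F := value (if q == coord (Some x) then None else Some x).

Lemma slope_neq x y q : x != y -> slope x q != slope y q.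
Proof.
move=> nxy; rewrite (inj_eq value_inj).
case: (q =P coord (Some x)) => [qx|_]; case: (q =P coord (Some y)) => [qy|_] //.
by move: nxy; rewrite -(inj_eq Some_inj) -(inj_eq coord_inj) -qx -qy eqxx.
Qed.

(* Supported on the coordinates of [Some y] and [None], where the slopes of [x] and
   [z] agree unless [z = y]; the weight normalizes the remaining difference. *)
Definition slope_dual x y q : F :=
  let w := ((value (Some x) - value None)^-1 - (value (Some x) - value (Some y))^-1)^-1 in
  if q == coord (Some y) then w else if q == coord None then - w else 0.

Lemma slope_dualP x y z : x != y -> x != z ->
  \sum_q slope_dual x y q / (slope x q - slope z q) = (z == y)%:R.
Proof.
move=> nxy nxz; rewrite (bigD1 (coord (Some y))) //= (bigD1 (coord None)) /=; last first.
  by rewrite (inj_eq coord_inj).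
rewrite big1 ?addr0 => [|q /andP[/negbTE qy /negbTE q0]]; last by rewrite /slope_dual qy q0 mul0r.
rewrite /slope_dual /slope !(inj_eq coord_inj) eqxx !(inj_eq Some_inj) /=.
rewrite (eq_sym y x) (negbTE nxy) (eq_sym y z); case: eqP => [->|_] /=; last by rewrite mulNr subrr.
rewrite mulNr -mulrBr mulVf // subr_eq0 (inj_eq invr_inj) (inj_eq (addrI _)).
by rewrite (inj_eq oppr_inj) (inj_eq value_inj).
Qed.

(* Triangular system: the shift of [p] only carries the prescriptions towards the
   points of larger rank. *)
Lemma exists_interpolating_shifts (T : finType) (b : T -> V) (phi : T -> T -> F) :
  injective b -> exists a : T -> K -> F, forall p p',
    (enum_rank (b p) < enum_rank (b p'))%N ->
    \sum_q (a p q - a p' q) / (slope (b p) q - slope (b p') q) = phi p p'.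
Proof.
move=> b_inj; pose lt p p' := (enum_rank (b p) < enum_rank (b p'))%N.
have lt_neq p p' : lt p p' -> b p != b p'.
  by rewrite /lt; apply: contraTneq => ->; rewrite ltnn.
pose a p q := \sum_(p' | lt p p') phi p p' * slope_dual (b p) (b p') q.
have sum_a p z : b p != z -> \sum_q a p q / (slope (b p) q - slope z q) =
    \sum_(p' | lt p p') phi p p' * (z == b p')%:R.
  move=> npz; under eq_bigr do rewrite mulr_suml.
  rewrite exchange_big /=; apply: eq_bigr => p' pp'; rewrite -(@slope_dualP (b p)) ?lt_neq //.
  by rewrite mulr_sumr; apply: eq_bigr => q _; rewrite mulrA.
exists a => p p' pp'; under eq_bigr do rewrite mulrBl.
rewrite sumrB sum_a ?lt_neq // (bigD1 p') //= eqxx mulr1 big1 ?addr0; last first.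
  by move=> p'' /andP[_ npp'']; rewrite (inj_eq b_inj) eq_sym (negbTE npp'') mulr0.
have -> : \sum_q a p' q / (slope (b p) q - slope (b p') q) = 0; last by rewrite subr0.
under eq_bigr do rewrite -opprB invrN mulrN.
rewrite sumrN sum_a 1?eq_sym ?lt_neq // big1 ?oppr0 // => p'' p'p''.
by rewrite (negbTE (lt_neq _ _ (ltn_trans pp' p'p''))) mulr0.
Qed.
End Slopes.

Section BlowUp.
Variables (k : nat) (C : finType) (col : 'I_k -> 'I_k -> C) (mu : C -> nat).
Hypothesis col_sym : forall p q, col p q = col q p.

Lemma edge_mult_sym (X : eqType) (b : 'I_k -> X) c x y :
  edge_mult col b c x y = edge_mult col b c y x.
Proof.
rewrite /edge_mult (reindex_inj (h := fun p : 'I_k * 'I_k => (p.2, p.1))) /=.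
  by apply: eq_big => [p|p _]; rewrite ?inE /= 1?eq_sym 1?col_sym // andbC.
by move=> [? ?] [? ?] [-> ->].
Qed.

Definition occurrences (I : finType) (X : eqType) (b : I -> 'I_k -> X) c x y :
    {set I * ('I_k * 'I_k)} :=
  [set ip | (ip.2 \in col_pairs col c) && ((b ip.1 ip.2.1 == x) && (b ip.1 ip.2.2 == y))].

Lemma sum_occurrences (I : finType) (X : eqType) (b : I -> 'I_k -> X) c x y
    (G : I -> 'I_k * 'I_k -> nat) :
  \sum_i \sum_(p in col_pairs col c) ((b i p.1 == x) && (b i p.2 == y)) * G i p =
  \sum_(ip in occurrences b c x y) G ip.1 ip.2.
Proof.
rewrite pair_big_dep /= big_mkcond [RHS]big_mkcond /=; apply: eq_bigr => -[i p] _ /=.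
by rewrite /occurrences in_set /=; case: (p \in _) => //; case: (_ && _); rewrite ?mul1n ?mul0n.
Qed.

Lemma card_occurrences (I : finType) (X : eqType) (b : I -> 'I_k -> X) c x y :
  #|occurrences b c x y| = \sum_i edge_mult col (b i) c x y.
Proof.
rewrite -sum1_card -(sum_occurrences b c x y (fun _ _ => 1)); apply: eq_bigr => i _.
by apply: eq_bigr => p _; rewrite muln1.
Qed.

Lemma exists_balanced_labels (L : finType) (l0 : L) (I V : finType) (r : rel V)
    (b : I -> 'I_k -> V) :
  (forall c x y, \sum_i edge_mult col (b i) c x y = #|L| * mu c * r x y) ->
  exists f : C -> V -> V -> I -> 'I_k * 'I_k -> L, forall c x y l,
    \sum_i \sum_(p in col_pairs col c)
      ((b i p.1 == x) && (b i p.2 == y)) * (f c x y i p == l) = mu c * r x y.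
Proof.
move=> bE.
have /choice [f fE] : forall cxy : C * V * V, exists f : I * ('I_k * 'I_k) -> L, forall l,
    #|[set ip in occurrences b cxy.1.1 cxy.1.2 cxy.2 | f ip == l]| = mu cxy.1.1 * r cxy.1.2 cxy.2.
  by move=> [[c x] y]; apply: uniform_coloring => //; rewrite card_occurrences bE mulnA.
exists (fun c x y i p => f (c, x, y) (i, p)) => c x y l.
rewrite -(fE (c, x, y) l) -sum1dep_card big_mkcondr /=.
rewrite (sum_occurrences _ _ _ _ (fun i p => f (c, x, y) (i, p) == l : nat)).
by apply: eq_bigr => -[i p] _ /=; case: (_ == _).
Qed.

Section ShiftedBlocks.
Variables (V : finType) (F : finFieldType) (K : finType).
Variables (coord : option V -> K) (value : option V -> F).
Hypothesis value_inj : injective value.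
Variables (I : finType) (b : I -> 'I_k -> V) (a : I -> 'I_k -> K -> F).
Local Notation U := {ffun K -> F}.
Local Notation d := (slope coord value).

Definition shifted_block (j : I * (U * {t | @null_sum F K t})) p : V * U :=
  (b j.1 p, line (a j.1 p) (d (b j.1 p)) j.2.1 (val j.2.2)).

Lemma sum_edge_mult_shifted c x y u v : injective coord -> x != y ->
  \sum_j edge_mult col (shifted_block j) c (x, u) (y, v) =
  \sum_i \sum_(p in col_pairs col c) ((b i p.1 == x) && (b i p.2 == y)) *
    (\sum_q (a i p.1 q - a i p.2 q) / (d x q - d y q) ==
     \sum_q (u q - v q) / (d x q - d y q))%R.
Proof.
move=> coord_inj nxy.
rewrite -(pair_bigA _ (fun i st => edge_mult col (shifted_block (i, st)) c (x, u) (y, v))) /=.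
apply: eq_bigr => i _; rewrite exchange_big /=; apply: eq_bigr => p _.
under eq_bigr do rewrite !xpair_eqE andbACA -mulnb /=.
rewrite -big_distrr /=; case: (b i p.1 =P x) => //= ->; case: (b i p.2 =P y) => //= ->.
by rewrite count_lines_through // => q; apply: slope_neq.
Qed.

End ShiftedBlocks.

(* Spread the occurrences of every edge evenly over [F]: shifting and developing the
   blocks then makes each element of [F] responsible for its share of the lifted edges. *)
Lemma decomposable_blowup (V : finType) (r : rel V) (F : finFieldType) n :
  irreflexive r -> symmetric r -> #|V| < #|F| -> #|V| < n ->
  decomposable col (fun c => #|F| * mu c) r ->
  decomposable col mu (fun x y : V * {ffun 'I_n -> F} => r x.1 y.1).
Proof.
move=> r_irr r_sym VF Vn [I [b bE]].
have [|value value_inj] := @exists_injection (option V) F; first by rewrite card_option.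
have [|coord coord_inj] := @exists_injection (option V) 'I_n; first by rewrite card_option card_ord.
have b_inj := blocks_inj r_irr bE.
have [f fE] := exists_balanced_labels (0%R : F) bE.
pose phi i p q := f (col p q) (b i p) (b i q) i (p, q).
have /choice [a aE] i := exists_interpolating_shifts coord_inj value_inj (phi i) (b_inj i).
exists _, (shifted_block coord value b a).
suff ordered c x y u v : enum_rank x < enum_rank y ->
    \sum_j edge_mult col (shifted_block coord value b a j) c (x, u) (y, v) = mu c * r x y.
  move=> c [x u] [y v] /=.
  case: (ltngtP (enum_rank x) (enum_rank y)) => [||/val_inj/enum_rank_inj <-].
  - exact: ordered.
  - by move=> /ordered yx; rewrite r_sym -(yx c v u); apply: eq_bigr => j _; apply: edge_mult_sym.
  rewrite r_irr muln0; apply: big1 => j _; apply: big1 => p /andP[npq _].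
  rewrite !xpair_eqE andbACA; case: (b j.1 p.1 =P x) => //= px; case: eqP => //= qx.
  by move: npq; rewrite (b_inj j.1 p.1 p.2) ?eqxx // px qx.
move=> ltxy; have nxy : x != y by apply: contraTneq ltxy => ->; rewrite ltnn.
pose d := slope coord value; pose target := (\sum_q (u q - v q) / (d x q - d y q))%R.
rewrite sum_edge_mult_shifted // -(fE c x y target).
apply: eq_bigr => i _; apply: eq_bigr => p /andP[_ /eqP cp].
case: (b i p.1 =P x) => //= px; case: (b i p.2 =P y) => //= qy.
by have := aE i p.1 p.2; rewrite /phi px qy cp -surjective_pairing => ->.
Qed.

End BlowUp.

(** * Integral combinations of blocks *)

Section IntegralSpan.
Local Open Scope ring_scope.
Variables (M : zmodType) (B : finType) (gen : B -> M).

Definition int_span : {pred M} :=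
  [pred f | `[< exists z : B -> int, f = \sum_b gen b *~ z b >]].

Lemma int_spanP f : reflect (exists z : B -> int, f = \sum_b gen b *~ z b) (f \in int_span).
Proof. exact: asboolP. Qed.

Lemma int_span_zmod_closed : zmod_closed int_span.
Proof.
split=> [|f g /int_spanP[z ->] /int_spanP[w ->]]; apply/int_spanP.
  by exists (fun=> 0); rewrite big1 // => b _; rewrite mulr0z.
exists (fun b => z b - w b); rewrite -sumrB; apply: eq_bigr => b _.
by rewrite mulrzBr.
Qed.

HB.instance Definition _ := GRing.isZmodClosed.Build M int_span int_span_zmod_closed.

Lemma int_span_gen b : gen b \in int_span.
Proof.
apply/int_spanP; exists (fun b' => (b' == b)%:R).
by rewrite (bigD1 b) //= eqxx big1 ?addr0 // => b' /negbTE ->; rewrite mulr0z.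
Qed.

(* Test the hypothesis on the quotient by the span. *)
Lemma int_span_separation (f : M) :
  (forall (G : zmodType) (phi : {additive M -> G}),
     (forall b, phi (gen b) = 0) -> phi f = 0) ->
  f \in int_span.
Proof.
move=> f_killed; pose Q := Quotient.quot int_span.
have pi_eq0 g : (g \in int_span) = (\pi_Q g == 0 :> Q)%qT.
  by rewrite -[0]pi_zeror -Quotient.idealrBE subr0.
rewrite pi_eq0; apply/eqP; apply: (f_killed Q (\pi_Q)%qT) => b.
by apply/eqP; rewrite -pi_eq0 int_span_gen.
Qed.
End IntegralSpan.

Lemma big_offdiag (R : Type) (idx : R) (op : Monoid.com_law idx) (T : finType)
    (P : rel T) (rk : T -> nat) (f : T -> T -> R) :
  injective rk -> symmetric P ->
  \big[op/idx]_(x : T * T | (x.1 != x.2) && P x.1 x.2) f x.1 x.2 =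
  \big[op/idx]_(x : T * T | (rk x.1 < rk x.2)%N && P x.1 x.2) op (f x.1 x.2) (f x.2 x.1).
Proof.
move=> rk_inj P_sym; rewrite big_split /=.
rewrite [X in op _ X](reindex_inj (h := fun p : T * T => (p.2, p.1))) /=; last first.
  by move=> [? ?] [? ?] [-> ->].
rewrite (bigID (fun x : T * T => rk x.1 < rk x.2)%N) /=; congr (op _ _);
  apply: eq_bigl => -[x y] /=; rewrite -(inj_eq rk_inj) 1?[P y x]P_sym;
  by case: ltngtP; rewrite ?andbF ?andbT.
Qed.

Lemma big_pairs_neq (R : Type) (idx : R) (op : Monoid.com_law idx) (T : finType)
    (f : T -> T -> R) :
  \big[op/idx]_(x : T * T | x.1 != x.2) f x.1 x.2 =
  \big[op/idx]_x \big[op/idx]_(y | y != x) f x y.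
Proof. by rewrite pair_big_dep /=; apply: eq_bigl => x; rewrite eq_sym. Qed.

Section Colours.
Variables (k : nat) (C : finType) (col : 'I_k -> 'I_k -> C).

Definition col_edges c : pred ('I_k * 'I_k) :=
  [pred p : 'I_k * 'I_k | (p.1 < p.2) && (col p.1 p.2 == c)].

Definition pos_degree c p := #|[pred q | (q != p) && (col p q == c)]|.

Lemma card_col_pairs c :
  (forall p q, col p q = col q p) -> #|col_pairs col c| = 2 * #|col_edges c|.
Proof.
move=> col_sym; rewrite -!sum1_card (big_offdiag addn (P := fun p q => col p q == c)
  (fun _ _ => 1) val_inj) => [|p q]; last by rewrite col_sym.
by rewrite big_distrr.
Qed.

Lemma sum_pos_degree c : \sum_p pos_degree c p = #|col_pairs col c|.
Proof.
rewrite -sum1_card /pos_degree; under eq_bigr do rewrite -sum1_card.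
by rewrite pair_big_dep; apply: eq_bigl => p; rewrite /= !inE eq_sym.
Qed.

Lemma sum_colours_at (G : nmodType) (g : C -> G) p :
  (\sum_(q | q != p) g (col p q) = \sum_c g c *+ pos_degree c p)%R.
Proof.
rewrite (partition_big (col p) xpredT) //=; apply: eq_bigr => c _.
by rewrite -sumr_const; apply: eq_bigr => q /andP[_ /eqP ->].
Qed.

Lemma sum_colours_edges (G : nmodType) (g : C -> G) :
  (\sum_(p : 'I_k * 'I_k | (p.1 < p.2)%N) g (col p.1 p.2) = \sum_c g c *+ #|col_edges c|)%R.
Proof.
rewrite (partition_big (fun p => col p.1 p.2) xpredT) //=; apply: eq_bigr => c _.
by rewrite -sumr_const; apply: eq_bigr => q /andP[_ /eqP ->].
Qed.

(* [z p] plays the role of the number of blocks in which a vertex of degree [d]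
   occupies the position [p]. *)
Definition degree_feasible (mu : C -> nat) d :=
  exists z : 'I_k -> nat, forall c, \sum_p z p * pos_degree c p = d * mu c.

(* [N] plays the role of the number of blocks, [n] counting ordered edges. *)
Definition edge_feasible (mu : C -> nat) n :=
  exists N, forall c, n * mu c = N * #|col_pairs col c|.
End Colours.

Section Multipartite.
Variables (k m s : nat).
Local Notation V := ('I_m * 'I_s)%type.

Definition adj (x y : V) := x.1 != y.1.
Definition clique (b : 'I_k -> V) := [forall p, forall q, (p != q) ==> adj (b p) (b q)].

Lemma adj_sym : symmetric adj. Proof. by move=> x y; rewrite /adj eq_sym. Qed.
Lemma adj_irr : irreflexive adj. Proof. by move=> x; rewrite /adj eqxx. Qed.

Lemma adj_neq x y : (x != y) && adj x y = adj x y.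
Proof. by case: eqP => //= ->; rewrite adj_irr. Qed.

Lemma card_adj x : #|[pred y | adj x y]| = (m - 1) * s.
Proof.
have := cardC [pred y : V | y.1 == x.1]; rewrite card_fst_fiber card_prod !card_ord.
have -> : #|[predC [pred y : V | y.1 == x.1]]| = #|[pred y | adj x y]|.
  by apply: eq_card => y; rewrite !inE eq_sym.
by rewrite mulnBl mul1n => <-; rewrite addKn.
Qed.

Lemma cliqueP b : reflect (forall p q, p != q -> adj (b p) (b q)) (clique b).
Proof.
by apply: (iffP forallP) => cb p; [move=> q; apply/implyP; apply/forallP: q; exact: cb
  | apply/forallP => q; apply/implyP; apply: cb].
Qed.

Lemma clique_finfun b : clique b -> clique (finfun b).
Proof. by move=> /cliqueP cb; apply/cliqueP => p q; rewrite !ffunE; apply: cb. Qed.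

Lemma clique_replace b p x : clique b -> (forall q, q != p -> adj x (b q)) ->
  clique [eta b with p |-> x].
Proof.
move=> /cliqueP cb xb; apply/cliqueP => q q' /=.
case: (q =P p) => [->|/eqP nqp]; case: (q' =P p) => [->|/eqP nq'p]; rewrite ?eqxx // => nqq'.
- exact: xb.
- by rewrite adj_sym; apply: xb.
- exact: cb.
Qed.

Hypotheses (m_ge : k + 4 <= m) (s_gt0 : 0 < s).

Lemma exists_common_neighbour (A : seq V) : size A < m ->
  exists z, forall x, x \in A -> adj x z.
Proof.
move=> Am; have /subsetPn [a _ aA] : ~~ ([set: 'I_m] \subset [seq x.1 | x <- A]).
  apply/negP => /subset_leq_card; rewrite cardsT card_ord leqNgt => /negP[].
  by apply: leq_ltn_trans (card_size _) _; rewrite size_map.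
exists (a, Ordinal s_gt0) => x xA; rewrite /adj /=.
by apply: contraNneq aA => <-; apply: map_f.
Qed.

Lemma exists_clique (A : seq V) : size A <= 4 ->
  exists b : 'I_k -> V, clique b /\ forall p x, x \in A -> adj x (b p).
Proof.
move=> A_le4; pose used := [seq x.1 | x <- A].
have k_free : k <= #|[predC used]|.
  rewrite -(leq_add2l #|used|) cardC card_ord; have := card_size used; rewrite size_map.
  move: #|used| => n; lia.
exists (fun p => (enum_val (widen_ord k_free p), Ordinal s_gt0)); split=> [|p x xA].
  apply/cliqueP => p q; apply: contra => /eqP/enum_val_inj/(congr1 val)/= /val_inj ->.
  exact: eqxx.
have := enum_valP (widen_ord k_free p); rewrite inE /adj /=.
by apply: contraNneq => <-; apply: map_f.
Qed.

Section Potential.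
Local Open Scope ring_scope.
Variables (G : zmodType) (w : V -> V -> G).
Hypothesis w_sym : forall x y, w x y = w y x.
Hypothesis w_square : forall x x' y y', adj x y -> adj x' y -> adj x y' -> adj x' y' ->
  w x y - w x' y = w x y' - w x' y'.

Lemma exists_potential r0 : exists (D : V -> G) (t : G),
  D r0 = 0 /\ forall x y, adj x y -> w x y = D x + D y + t.
Proof.
have /choice [nb nbP] x : exists z, adj x z && adj r0 z.
  have [|z zP] := @exists_common_neighbour [:: x; r0]; first by rewrite /=; lia.
  by exists z; rewrite !zP // !inE eqxx ?orbT.
pose D x := w x (nb x) - w r0 (nb x).
have DE x z : adj x z -> adj r0 z -> D x = w x z - w r0 z.
  by have /andP[? ?] := nbP x; exact: w_square.
have D_diff x x' y : adj x y -> adj x' y -> w x y - w x' y = D x - D x'.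
  move=> xy x'y; have [|z zP] := @exists_common_neighbour [:: x; x'; r0]; first by rewrite /=; lia.
  have [xz x'z rz] : [/\ adj x z, adj x' z & adj r0 z] by split; apply: zP; rewrite !inE eqxx ?orbT.
  by rewrite (w_square xy x'y xz x'z) (DE _ _ xz rz) (DE _ _ x'z rz) opprB addrA subrK.
have /andP[_ r01] := nbP r0; set r1 := nb r0 in r01.
exists D, (w r0 r1 - D r1); split=> [|x y xy]; first exact: subrr.
have [|z zP] := @exists_common_neighbour [:: x; r0]; first by rewrite /=; lia.
have [xz rz] : adj x z /\ adj r0 z by split; apply: zP; rewrite !inE eqxx ?orbT.
have wxy : w x y = D y - D z + w x z.
  by apply/eqP; rewrite -subr_eq !(w_sym x) D_diff // adj_sym.
have wxz : w x z = D x + w r0 z by apply/eqP; rewrite -subr_eq (DE _ _ xz rz).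
have wrz : w r0 z = D z - D r1 + w r0 r1.
  by apply/eqP; rewrite -subr_eq !(w_sym r0) D_diff // adj_sym.
rewrite wxy wxz wrz; move: (D x) (D y) (D z) (D r1) (w r0 r1) => Dx Dy Dz Dr1 w01.
by rewrite !addrA [LHS](ACl (3*1*6*5*4*2)) /= addrK.
Qed.
End Potential.

Section EdgeWeights.
Variables (C : finType) (col : 'I_k -> 'I_k -> C) (mu : C -> nat).
Hypothesis col_sym : forall p q, col p q = col q p.
Hypothesis col_occurs : forall c, 0 < #|col_pairs col c|.
Local Open Scope ring_scope.
Variables (G : zmodType) (E : C -> V -> V -> G).
Hypothesis E_block : forall b, clique b ->
  \sum_(p : 'I_k * 'I_k | p.1 != p.2) E (col p.1 p.2) (b p.1) (b p.2) = 0.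
Local Notation w c x y := (E c x y + E c y x).

(* Alternate over the four blocks with [x] or [x'] at a position and [y] or [y'] at
   another one: all pairs of positions but those two cancel. *)
Lemma edge_weight_square c x x' y y' :
  adj x y -> adj x' y -> adj x y' -> adj x' y' ->
  w c x y - w c x' y = w c x y' - w c x' y'.
Proof.
move=> xy x'y xy' x'y'.
have /card_gt0P [[p q] /andP[/= npq /eqP cpq]] := col_occurs c.
have [b [cb bA]] := @exists_clique [:: x; x'; y; y'] isT.
pose B z t := [eta [eta b with p |-> z] with q |-> t].
pose rest z t := \sum_(i : 'I_k * 'I_k | (i.1 != i.2) && (i \notin [:: (p, q); (q, p)]))
  E (col i.1 i.2) (B z t i.1) (B z t i.2).
have block_sum z t : z \in [:: x; x'] -> t \in [:: y; y'] -> adj z t -> w c z t = - rest z t.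
  move=> zX tY zt; apply/eqP; rewrite -addr_eq0; apply/eqP.
  have zA : z \in [:: x; x'; y; y'] by move: zX; rewrite !inE => /orP[] ->; rewrite ?orbT.
  have tA : t \in [:: x; x'; y; y'] by move: tY; rewrite !inE => /orP[] ->; rewrite ?orbT.
  have cB : clique (B z t).
    apply: clique_replace => [|i _ /=]; first by apply: clique_replace => // i _; apply: bA.
    by case: eqP => _; [rewrite adj_sym | apply: bA].
  rewrite -(E_block cB) (bigD1 (p, q)) //= (bigD1 (q, p)) /=; last first.
    by rewrite eq_sym npq xpair_eqE negb_and eq_sym npq.
  rewrite !eqxx (negbTE npq) (col_sym q p) cpq -addrA; congr (_ + (_ + _)).
  by apply: eq_bigl => i; rewrite !inE negb_or andbA.
rewrite !block_sum ?inE ?eqxx ?orbT // !opprK ![- _ + _]addrC -!sumrB.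
apply: eq_bigr => -[i j] /= /andP[nij ij].
have /orP[/andP[/negbTE ip /negbTE jp]|/andP[/negbTE iq /negbTE jq]] :
    (i != p) && (j != p) || (i != q) && (j != q).
  move: nij ij; rewrite !inE !xpair_eqE; case: (i =P p) => [->|_]; case: (j =P p) => [->|_] //=;
    by rewrite ?eqxx // npq ?andbF ?andbT ?orbF.
- by rewrite ip jp !subrr.
- by rewrite iq jq.
Qed.

Section WithPotential.
Variables (D : C -> V -> G) (t : C -> G) (r0 : V).
Hypothesis D0 : forall c, D c r0 = 0.
Hypothesis E_potential : forall c x y, adj x y -> w c x y = D c x + D c y + t c.

Lemma block_potential b : clique b ->
  \sum_p \sum_c D c (b p) *+ pos_degree col c p + \sum_c t c *+ #|col_edges col c| = 0.
Proof.
move=> cb; rewrite -[RHS](E_block cb).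
have offdiag f : \sum_(p : 'I_k * 'I_k | p.1 != p.2) f p.1 p.2 =
    \sum_(p : 'I_k * 'I_k | (p.1 < p.2)%N) (f p.1 p.2 + f p.2 p.1) :> G.
  have := big_offdiag (+%R : Monoid.com_law (0 : G)) (P := fun _ _ => true) f (@val_inj _ _ _)
    (fun _ _ => erefl).
  by rewrite !(eq_bigl _ _ (fun p => andbT _)).
rewrite (offdiag (fun p q => E (col p q) (b p) (b q))) -sum_colours_edges.
under eq_bigr do rewrite -sum_colours_at.
rewrite -(big_pairs_neq _ (fun p q => D (col p q) (b p))) (offdiag (fun p q => D (col p q) (b p))).
rewrite -big_split /=; apply: eq_bigr => -[p q] /= pq.
rewrite (col_sym q p) -E_potential //; apply: (cliqueP _ cb).
by rewrite -val_eqE /= neq_ltn pq.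
Qed.

Lemma pos_potential p x : \sum_c D c x *+ pos_degree col c p = 0.
Proof.
pose S q z := \sum_c D c z *+ pos_degree col c q; rewrite -/(S p x).
suff -> : S p x = S p r0 by apply: big1 => c _; rewrite D0 mul0rn.
have [b [cb bA]] := @exists_clique [:: x; r0] isT.
have block z : z \in [:: x; r0] ->
    S p z + (\sum_(q | q != p) S q (b q) + \sum_c t c *+ #|col_edges col c|) = 0.
  move=> zA; have cbz := clique_replace (p := p) cb (fun q _ => bA q z zA).
  rewrite -[RHS](block_potential cbz) [in RHS](bigD1 p) //= eqxx -addrA; congr (_ + (_ + _)).
  by apply: eq_bigr => q /negbTE ->.
by apply: addIr (etrans (block x _) (esym (block r0 _))); rewrite !inE eqxx ?orbT.
Qed.

Lemma edge_potential : \sum_c t c *+ #|col_edges col c| = 0.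
Proof.
have [b [cb _]] := @exists_clique [::] isT.
by rewrite -[RHS](block_potential cb) [in RHS]big1 ?add0r // => p _; apply: pos_potential.
Qed.

Let rank_inj : injective (fun x : V => enum_rank x : nat).
Proof. by move=> x y /val_inj/enum_rank_inj. Qed.

Lemma sum_adj_potential c : \sum_(x : V * V | adj x.1 x.2) E c x.1 x.2 =
  \sum_x D c x *+ ((m - 1) * s) +
  t c *+ #|[pred x : V * V | (enum_rank x.1 < enum_rank x.2)%N && adj x.1 x.2]|.
Proof.
have neq_adj f : \sum_(x : V * V | adj x.1 x.2) f x.1 x.2 =
    \sum_(x : V * V | (x.1 != x.2) && adj x.1 x.2) f x.1 x.2 :> G.
  by apply: eq_bigl => x; rewrite adj_neq.
rewrite neq_adj (big_offdiag +%R (E c) rank_inj adj_sym).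
rewrite (eq_bigr (fun x => D c x.1 + D c x.2 + t c)) => [|x /andP[_]]; last exact: E_potential.
rewrite big_split /= sumr_const; congr (_ + _).
rewrite -(big_offdiag +%R (fun x _ => D c x) rank_inj adj_sym) -(neq_adj (fun x _ => D c x)).
rewrite (eq_bigl (fun x : V * V => true && adj x.1 x.2)) //.
rewrite -(pair_big_dep xpredT adj (fun x _ => D c x)) /=; apply: eq_bigr => x _.
by rewrite sumr_const card_adj.
Qed.

Lemma card_adj_pairs :
  (m * s * ((m - 1) * s) =
   2 * #|[pred x : V * V | (enum_rank x.1 < enum_rank x.2)%N && adj x.1 x.2]|)%N.
Proof.
transitivity (\sum_(x : V * V | (x.1 != x.2) && adj x.1 x.2) 1)%N.
  rewrite (eq_bigl (fun x : V * V => true && adj x.1 x.2)); last by move=> x; rewrite adj_neq.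
  rewrite -(pair_big_dep xpredT adj (fun _ _ => 1%N)) /=.
  rewrite (eq_bigr (fun=> (m - 1) * s)%N) => [|x _]; last by rewrite sum1_card card_adj.
  by rewrite sum_nat_const card_prod !card_ord.
by rewrite (big_offdiag addn (fun _ _ => 1%N) rank_inj adj_sym) sum_nat_const mulnC.
Qed.

Lemma weighted_edge_sum_eq0_of_potential :
  degree_feasible col mu ((m - 1) * s) -> edge_feasible col mu (m * s * ((m - 1) * s)) ->
  \sum_c (\sum_(x : V * V | adj x.1 x.2) E c x.1 x.2) *+ mu c = 0.
Proof.
move=> [z zE] [N NE]; under eq_bigr do rewrite sum_adj_potential mulrnDl -!mulrnA.
rewrite big_split /=; set n := #|_|.
have nE c : (n * mu c = N * #|col_edges col c|)%N.
  apply/eqP; rewrite -(eqn_pmul2l (isT : 0 < 2)%N) mulnA -card_adj_pairs NE.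
  by rewrite card_col_pairs // mulnCA.
rewrite [X in _ + X](_ : _ = (\sum_c t c *+ #|col_edges col c|) *+ N); last first.
  by rewrite -sumrMnl; apply: eq_bigr => c _; rewrite nE mulnC mulrnA.
rewrite edge_potential mul0rn addr0.
under eq_bigr do rewrite -sumrMnl; rewrite exchange_big big1 // => x _ /=.
under eq_bigr do rewrite -mulrnA -zE -sumrMnr; rewrite exchange_big big1 // => p _ /=.
under eq_bigr do rewrite mulnC mulrnA.
by rewrite sumrMnl pos_potential mul0rn.
Qed.
End WithPotential.

Lemma weighted_edge_sum_eq0 :
  degree_feasible col mu ((m - 1) * s) -> edge_feasible col mu (m * s * ((m - 1) * s)) ->
  \sum_c (\sum_(x : V * V | adj x.1 x.2) E c x.1 x.2) *+ mu c = 0.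
Proof.
have m_gt0 : (0 < m)%N by lia.
pose r0 : V := (Ordinal m_gt0, Ordinal s_gt0).
have /choice [D /choice [t Dt]] : forall c, exists (D : V -> G) (t : G), D r0 = 0 /\
    forall x y, adj x y -> w c x y = D x + D y + t.
  move=> c; apply: (exists_potential (w := fun x y => w c x y)) => [x y|].
    exact: addrC.
  exact: edge_weight_square.
by apply: (@weighted_edge_sum_eq0_of_potential D t r0) => c; have [] := Dt c.
Qed.
End EdgeWeights.
End Multipartite.

(** * Nonnegative combinations *)

Lemma perm_two_transitive (T : finType) (x y x' y' : T) : x != y -> x' != y' ->
  exists g : {perm T}, g x = x' /\ g y = y'.
Proof.
move=> nxy nxy'; exists (tperm x x' * tperm (tperm x x' y) y')%g.
rewrite !permM tpermL tpermL tpermD //; last by rewrite eq_sym.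
by rewrite -{2}(tpermL x x') (inj_eq perm_inj) eq_sym.
Qed.

Section MultipartiteBlocks.
Variables (k m s : nat).
Hypotheses (k_gt1 : 1 < k) (m_ge : k + 4 <= m) (s_gt0 : 0 < s).
Local Notation V := ('I_m * 'I_s)%type.
Local Notation blk := {b : {ffun 'I_k -> V} | clique b}.

Lemma adj_arc_transitive (x y x' y' : V) : adj x y -> adj x' y' ->
  exists g : V -> V, [/\ injective g, forall u v, adj (g u) (g v) = adj u v, g x = x' & g y = y'].
Proof.
case: x y x' y' => [x1 x2] [y1 y2] [x1' x2'] [y1' y2']; rewrite /adj /= => nxy nxy'.
have [g [gx gy]] := perm_two_transitive nxy nxy'.
pose h (a : 'I_m) : {perm 'I_s} :=
  if a == x1 then tperm x2 x2' else if a == y1 then tperm y2 y2' else 1%g.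
exists (fun u => (g u.1, h u.1 u.2)); split=> [[u1 u2] [v1 v2] /= [/perm_inj ->]|u v /=|/=|/=].
- by move/perm_inj ->.
- by rewrite (inj_eq perm_inj).
- by rewrite gx /h eqxx tpermL.
- by rewrite gy /h eq_sym (negbTE nxy) eqxx tpermL.
Qed.

Definition cliques_at p q (x y : V) : {set blk} := [set b : blk | (val b p == x) && (val b q == y)].

Lemma leq_card_cliques_at p q x y p' q' x' y' :
  p != q -> p' != q' -> adj x y -> adj x' y' -> #|cliques_at p q x y| <= #|cliques_at p' q' x' y'|.
Proof.
move=> npq npq' xy xy'; have [g [g_inj g_adj gx gy]] := adj_arc_transitive xy xy'.
have [h [hp hq]] := perm_two_transitive npq' npq.
have f_clique (b : blk) : clique [ffun i => g (val b (h i))].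
  apply/cliqueP => i j nij; rewrite !ffunE g_adj; apply: (cliqueP _ (valP b)).
  by rewrite (inj_eq perm_inj).
pose f (b : blk) : blk := Sub [ffun i => g (val b (h i))] (f_clique b).
have f_inj : injective f.
  move=> b b' /(congr1 val)/= /ffunP fE; apply/val_inj/ffunP => i.
  by have := fE (h^-1%g i); rewrite !ffunE permKV => /g_inj.
rewrite -(card_imset _ f_inj); apply: subset_leq_card; apply/subsetP => _ /imsetP[b bP ->].
move: bP; rewrite !inE => /andP[/eqP xp /eqP yq].
by rewrite /= !ffunE hp hq xp yq gx gy !eqxx.
Qed.

Lemma card_clique_gt0 : 0 < #|{: blk}|.
Proof.
have [b [cb _]] := @exists_clique k m s m_ge s_gt0 [::] isT.
by apply/card_gt0P; exists (Sub (finfun b) (clique_finfun cb)).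
Qed.

Lemma sum_edge_mult_cliques (C : finType) (col : 'I_k -> 'I_k -> C) :
  exists2 R, 0 < R & forall c x y,
    \sum_(b : blk) edge_mult col (val b) c x y = #|col_pairs col c| * R * adj x y.
Proof.
pose p0 := Ordinal (ltnW k_gt1); pose p1 := Ordinal k_gt1; have npp : p0 != p1 by [].
have /card_gt0P[b0 _] := card_clique_gt0.
have adj01 : adj (val b0 p0) (val b0 p1) by apply: (cliqueP _ (valP b0)).
exists #|cliques_at p0 p1 (val b0 p0) (val b0 p1)|.
  by apply/card_gt0P; exists b0; rewrite inE !eqxx.
move=> c x y; rewrite exchange_big /= -mulnA -sum_nat_const.
apply: eq_bigr => -[p q] /andP[/= npq _].
transitivity #|cliques_at p q x y|.
  rewrite /cliques_at -sum1dep_card [RHS]big_mkcond; apply: eq_bigr => b _.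
  by case: (_ && _).
have [xy|nxy] := boolP (adj x y).
  by rewrite muln1; apply/eqP; rewrite eqn_leq !leq_card_cliques_at.
rewrite muln0; apply/eqP; rewrite cards_eq0 -subset0; apply/subsetP => b; rewrite !inE.
by move=> /andP[/eqP xp /eqP yq]; have := cliqueP _ (valP b) _ _ npq; rewrite xp yq (negbTE nxy).
Qed.

Section Colouring.
Variables (C : finType) (col : 'I_k -> 'I_k -> C) (mu : C -> nat).
Hypothesis col_sym : forall p q, col p q = col q p.
Hypothesis col_occurs : forall c, 0 < #|col_pairs col c|.

Section SignedCombination.
Local Open Scope ring_scope.
Local Notation M := {ffun C * V * V -> int}.

Let unit_at c x y : M := [ffun t => (t == (c, x, y))%:R].

Lemma unit_at_sum_block (b : 'I_k -> V) :
  \sum_(p : 'I_k * 'I_k | p.1 != p.2) unit_at (col p.1 p.2) (b p.1) (b p.2) =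
  [ffun t => (edge_mult col b t.1.1 t.1.2 t.2)%:Z].
Proof.
apply/ffunP => -[[c x] y]; rewrite sum_ffunE ffunE /= /edge_mult.
rewrite (big_morph Posz PoszD (erefl _)) [RHS]big_mkcondr /=; apply: eq_bigr => p _.
rewrite !ffunE !xpair_eqE (eq_sym c) (eq_sym x) (eq_sym y).
by case: (_ == c) => //=; case: (_ && _).
Qed.

Lemma unit_at_sum_edges :
  \sum_c (\sum_(x : V * V | adj x.1 x.2) unit_at c x.1 x.2) *+ mu c =
  [ffun t => (mu t.1.1 * adj t.1.2 t.2)%:Z].
Proof.
apply/ffunP => -[[c x] y]; rewrite sum_ffunE ffunE /=.
have colour_sum c' : (\sum_(u : V * V | adj u.1 u.2) unit_at c' u.1 u.2) (c, x, y) =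
    ((c == c') && adj x y)%:R.
  rewrite sum_ffunE big_mkcond (bigD1 (x, y)) //= big1 ?addr0 => [|[u v] nuv].
    by rewrite ffunE !xpair_eqE !eqxx !andbT andbC; case: (adj x y).
  case: ifP => // _; rewrite ffunE; case: eqP => // -[_ xu yv].
  by rewrite xu yv eqxx in nuv.
rewrite (bigD1 c) //= ffunMnE colour_sum eqxx big1 ?addr0 => [|c' nc'].
  by rewrite -mulrnA mulnC natz.
by rewrite ffunMnE colour_sum eq_sym (negbTE nc') mul0rn.
Qed.

Lemma exists_signed_combination :
  degree_feasible col mu ((m - 1) * s) -> edge_feasible col mu (m * s * ((m - 1) * s)) ->
  exists z : blk -> int, forall c x y,
    \sum_b z b * (edge_mult col (val b) c x y)%:Z = (mu c * adj x y)%:Z.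
Proof.
move=> deg_ok edge_ok.
pose gen (b : blk) : M := [ffun t => (edge_mult col (val b) t.1.1 t.1.2 t.2)%:Z].
have : ([ffun t => (mu t.1.1 * adj t.1.2 t.2)%:Z] : M) \in int_span gen.
  apply: int_span_separation => G phi phi_gen; rewrite -unit_at_sum_edges raddf_sum.
  under eq_bigr do rewrite raddfMn raddf_sum.
  apply: (@weighted_edge_sum_eq0 k m s m_ge s_gt0 C col mu col_sym col_occurs G
    (fun c x y => phi (unit_at c x y))) => // b cb.
  rewrite -raddf_sum unit_at_sum_block -[RHS](phi_gen (Sub (finfun b) (clique_finfun cb))).
  congr (phi _).
  apply/ffunP => t; rewrite !ffunE; congr Posz; apply: eq_bigr => p _.
  by rewrite /= !ffunE.
move=> /int_spanP[z zE]; exists z => c x y.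
have := congr1 (fun f : M => f (c, x, y)) zE; rewrite sum_ffunE ffunE /= => ->.
apply: eq_bigr => b _; rewrite mulrC -mulrzz.
by case: (z b) => n; rewrite ?NegzE ?mulrNz ?ffunE -?pmulrn ffunMnE ffunE.
Qed.
End SignedCombination.

(* Writing [q = u + w A] with [u < A] and [w] large, take [u] copies of the signed
   combination and add enough copies of the family of all blocks. *)
Lemma decomposable_scale (X B : finType) (b : B -> 'I_k -> X) (r : rel X) (z : B -> int) e l R :
  0 < e -> 0 < l -> 0 < R -> (forall c, e * mu c = l * #|col_pairs col c|) ->
  (forall c x y, (\sum_i z i * (edge_mult col (b i) c x y)%:Z = (mu c * r x y)%:Z)%R) ->
  (forall c x y, \sum_i edge_mult col (b i) c x y = #|col_pairs col c| * R * r x y) ->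
  exists q0, forall q, q0 <= q -> decomposable col (fun c => q * mu c) r.
Proof.
move=> e_gt0 l_gt0 R_gt0 muE zE bE; pose A := e * R; pose Z := \sum_i absz (z i).
have A_gt0 : 0 < A by rewrite muln_gt0 e_gt0.
exists (A * (A * Z)) => q q_ge; pose u := q %% A; pose w := q %/ A.
have copies_ge0 i : (0 <= u%:Z * z i + (w * l)%:Z)%R.
  have u_lt : u < A by rewrite ltn_mod.
  have zi_le : absz (z i) <= Z by rewrite /Z (bigD1 i) //= leq_addr.
  have w_ge : A * Z <= w by rewrite /w leq_divRL // mulnC.
  have : u * absz (z i) <= w * l.
    by apply: leq_trans (leq_mul (ltnW u_lt) zi_le) (leq_trans w_ge _); rewrite leq_pmulr.
  by move: (w * l) => W; clear; nia.
pose copies i := absz (u%:Z * z i + (w * l)%:Z)%R.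
exists {i : B & 'I_(copies i)}, (fun i => b (tag i)) => c x y.
rewrite -(sig_big_dep xpredT (fun _ => xpredT)
  (fun i (_ : 'I_(copies i)) => edge_mult col (b i) c x y)) /=.
under eq_bigr do rewrite sum_nat_const card_ord.
apply/eqP; rewrite -eqz_nat (big_morph Posz PoszD (erefl _)); apply/eqP.
under eq_bigr do rewrite PoszM gez0_abs // mulrDl -mulrA.
rewrite big_split -!mulr_sumr zE /= -(big_morph Posz PoszD (erefl _)) bE -!PoszM -PoszD; congr Posz.
rewrite [in RHS](divn_eq q A) -/u -/w /A.
have -> : w * l * (#|col_pairs col c| * R * r x y) =
    w * R * r x y * (l * #|col_pairs col c|) by ring.
by rewrite -muE; ring.
Qed.

Lemma decomposable_multipartite e l :
  0 < e -> 0 < l -> (forall c, e * mu c = l * #|col_pairs col c|) ->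
  degree_feasible col mu ((m - 1) * s) -> edge_feasible col mu (m * s * ((m - 1) * s)) ->
  exists q0, forall q, q0 <= q -> decomposable col (fun c => q * mu c) (@adj m s).
Proof.
move=> e_gt0 l_gt0 muE deg_ok edge_ok.
have [R R_gt0 RE] := sum_edge_mult_cliques col.
have [z zE] := exists_signed_combination deg_ok edge_ok.
exact: decomposable_scale e_gt0 l_gt0 R_gt0 muE zE RE.
Qed.

Lemma has_GDD_blowup (F : finFieldType) n : m * s < #|F| -> m * s < n ->
  decomposable col (fun c => #|F| * mu c) (@adj m s) -> has_GDD col mu (s * #|F| ^ n) m.
Proof.
have cV : #|{: V}| = m * s by rewrite card_prod !card_ord.
rewrite -cV => VF Vn dec.
have := decomposable_blowup col_sym (@adj_irr m s) (@adj_sym m s) VF Vn dec.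
by apply: has_GDD_assoc; rewrite ?card_ffun !card_ord.
Qed.
End Colouring.
End MultipartiteBlocks.

(** * Cyclotomic classes *)

Lemma chebyshev_half (J : finType) (X : J -> nat) n :
  ((#|[set j | 2 * X j < n]%N| * n ^ 2)%:Z <= 4 * \sum_j ((X j)%:Z - n%:Z) ^+ 2)%R.
Proof.
rewrite (bigID [in [set j | 2 * X j < n]]) /= mulrDr; apply: ler_wpDr.
  by apply: mulr_ge0 => //; apply: sumr_ge0 => j _; apply: sqr_ge0.
rewrite PoszM -[X in (X * _)%R]natz mulr_natl -sumr_const mulr_sumr; apply: ler_sum => j.
rewrite inE -mulnn PoszM => Xj; rewrite -subr_ge0.
have -> : (4 * ((X j)%:Z - n%:Z) ^+ 2 - n%:Z * n%:Z =
  (n%:Z - 2 * (X j)%:Z) * (3 * n%:Z - 2 * (X j)%:Z))%R by ring.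
by apply: mulr_ge0; lia.
Qed.

Section PowerResidues.
Local Open Scope ring_scope.
Variables (F : finFieldType) (e f : nat).
Hypotheses (e_gt0 : (0 < e)%N) (f_gt0 : (0 < f)%N) (cardF : #|F| = (e * f).+1).

Definition unity_roots : {set F} := [set x | x ^+ e == 1].

Lemma leq_card_expr_eq n (c : F) : (0 < n)%N -> (#|[set x : F | x ^+ n == c]| <= n)%N.
Proof.
move=> n_gt0; have := @max_poly_roots F ('X^n - c%:P) (enum [set x : F | x ^+ n == c]).
rewrite -size_poly_eq0 size_XnsubC // => /(_ isT) roots_le; rewrite cardE -ltnS.
apply: roots_le; last exact: enum_uniq.
by apply/allP => x; rewrite mem_enum inE => /eqP xn; rewrite rootE !hornerE xn subrr.
Qed.

Lemma expr_unity_roots x : x != 0 -> x ^+ f \in unity_roots.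
Proof.
move=> x0; rewrite inE -exprM; apply/eqP; apply: (mulfI x0); rewrite -exprS mulr1.
by rewrite mulnC -cardF expf_card.
Qed.

Lemma unity_roots_neq0 c : c \in unity_roots -> c != 0.
Proof.
by rewrite inE; apply: contraTneq => ->; rewrite expr0n eqn0Ngt e_gt0 eq_sym oner_eq0.
Qed.

Lemma card_unity_roots : #|unity_roots| = e.
Proof.
apply/eqP; rewrite eqn_leq leq_card_expr_eq //= -(leq_pmul2r f_gt0).
have -> : (e * f = #|[set~ (0%R : F)]|)%N by rewrite cardsC1 cardF.
rewrite -sum1_card (partition_big (fun x : F => x ^+ f) [in unity_roots]) /=; last first.
  by move=> x; rewrite !inE => x0; have := expr_unity_roots x0; rewrite inE.
rewrite -sum_nat_const; apply: leq_sum => c _.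
rewrite sum1_card; apply: leq_trans (leq_card_expr_eq c f_gt0).
by apply: subset_leq_card; apply/subsetP => x; rewrite !inE => /andP[].
Qed.

Lemma sum_expr_eq t : (\sum_(c in unity_roots) \sum_a ((t - a) ^+ f == c) = e * f)%N.
Proof.
rewrite exchange_big /= (bigD1 t) //= big1 ?add0n => [|c cR]; last first.
  by rewrite subrr expr0n eqn0Ngt f_gt0 eq_sym (negbTE (unity_roots_neq0 cR)).
rewrite (eq_bigr (fun=> 1%N)) ?sum1_card ?cardC1 ?cardF // => a nta.
have taR : (t - a) ^+ f \in unity_roots by apply: expr_unity_roots; rewrite subr_eq0 eq_sym.
rewrite (bigD1 ((t - a) ^+ f)) //= eqxx big1 ?addn0 // => c /andP[_ nc].
by rewrite eq_sym (negbTE nc).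
Qed.

(* The map [a |-> (t - a) / (t' - a)] is injective and omits [1]. *)
Lemma leq_card_expr_eq2 t t' :
  t != t' -> (#|[set a : F | (t - a) ^+ f == (t' - a) ^+ f]| <= f - 1)%N.
Proof.
move=> ntt'; set A := [set a | _]; pose H := [set h : F | h ^+ f == 1].
have t'A a : a \in A -> t' - a != 0.
  rewrite inE; apply: contraTneq => t'a; move: ntt'; rewrite t'a expr0n eqn0Ngt f_gt0 expf_eq0.
  by rewrite f_gt0 subr_eq0 -(inj_eq (addIr (- a))) t'a subr_eq0.
apply: (@leq_trans #|H :\ 1|); last first.
  have := leq_card_expr_eq 1 f_gt0; rewrite -/H (cardsD1 1 H) inE expr1n eqxx /=.
  by move=> H_le; rewrite -[leqLHS](addKn 1%N) leq_sub2r.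
rewrite -(card_in_imset (f := fun a => (t - a) / (t' - a)) (D := A)).
  apply: subset_leq_card; apply/subsetP => _ /imsetP[a aA ->].
  have t'a := t'A a aA; move: aA; rewrite !inE expr_div_n => /eqP ->.
  rewrite divff ?expf_neq0 // eqxx andbT; apply: contra ntt' => /eqP.
  by move/(canRL (mulfVK t'a)); rewrite mul1r => /addIr ->.
move=> a a' aA a'A; have [t'a t'a'] := (t'A _ aA, t'A _ a'A).
move/eqP; rewrite eqr_div // -subr_eq0.
have -> : (t - a) * (t' - a') - (t - a') * (t' - a) = (t - t') * (a - a') by ring.
by rewrite mulf_eq0 !subr_eq0 (negbTE ntt') => /eqP.
Qed.

Lemma sum_expr_eq2_le t t' : t != t' ->
  (\sum_(c in unity_roots) \sum_a ((t - a) ^+ f == c) * ((t' - a) ^+ f == c) <= f - 1)%N.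
Proof.
move=> /leq_card_expr_eq2; apply: leq_trans; rewrite exchange_big -sum1_card [leqRHS]big_mkcond.
apply: leq_sum => a _; rewrite inE; case: eqP => [tt'|ntt'].
  have [taR|taR] := boolP ((t - a) ^+ f \in unity_roots).
    rewrite (bigD1 ((t - a) ^+ f)) //= -tt' eqxx big1 // => c /andP[_ nc].
    by rewrite eq_sym (negbTE nc).
  by rewrite big1 // => c cR; case: eqP => // tac; rewrite tac cR in taR.
by rewrite big1 // => c _; case: eqP => // tac; case: eqP => // t'ac; case: ntt'; rewrite tac t'ac.
Qed.

Section SecondMoment.
Variable T : {set F}.

Definition shifted_class c a := [set t in T | (t - a) ^+ f == c].

Lemma card_shifted_class c a : (#|shifted_class c a| = \sum_(t in T) ((t - a) ^+ f == c))%N.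
Proof.
by rewrite -sum1dep_card big_mkcondr; apply: eq_bigr => t _; case: (_ == _).
Qed.

Lemma sum_shifted_class :
  (\sum_(c in unity_roots) \sum_a #|shifted_class c a| = #|T| * (e * f))%N.
Proof.
under eq_bigr do under eq_bigr do rewrite card_shifted_class.
under eq_bigr do rewrite exchange_big /=.
rewrite exchange_big /= -sum_nat_const; apply: eq_bigr => t _; exact: sum_expr_eq.
Qed.

Lemma sum_sqr_shifted_class_le :
  (\sum_(c in unity_roots) \sum_a #|shifted_class c a| ^ 2 <=
   #|T| * (e * f) + #|T| * #|T| * (f - 1))%N.
Proof.
have sqrE c a : (#|shifted_class c a| ^ 2 =
    \sum_(t in T) \sum_(t' in T) ((t - a) ^+ f == c) * ((t' - a) ^+ f == c))%N.
  rewrite -mulnn card_shifted_class big_distrl /=.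
  by apply: eq_bigr => t _; rewrite big_distrr.
under eq_bigr do under eq_bigr do rewrite sqrE.
under eq_bigr do rewrite exchange_big /=.
rewrite exchange_big /= -mulnA -mulnDr -sum_nat_const; apply: leq_sum => t tT.
under eq_bigr do rewrite exchange_big /=.
rewrite exchange_big /= (bigD1 t) //=; apply: leq_add.
  rewrite -(sum_expr_eq t); apply: leq_sum => c _; apply: leq_sum => a _.
  by rewrite mulnb andbb.
apply: (@leq_trans (\sum_(t' in T | t' != t) (f - 1))%N).
  by apply: leq_sum => t' /andP[_ nt't]; apply: sum_expr_eq2_le; rewrite eq_sym.
rewrite sum_nat_const leq_mul2r; apply/orP; right; apply: subset_leq_card.
by apply/subsetP => t'; rewrite unfold_in => /andP[].
Qed.

Lemma sum_deviation_le :
  \sum_(c in unity_roots) \sum_a ((e * #|shifted_class c a|)%:Z - #|T|%:Z) ^+ 2 <=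
  (2 * e ^ 2 * #|T| * #|F|)%:Z.
Proof.
have devE c a : ((e * #|shifted_class c a|)%:Z - #|T|%:Z) ^+ 2 =
    e%:Z ^+ 2 * (#|shifted_class c a| ^ 2)%:Z - 2 * e%:Z * #|T|%:Z * #|shifted_class c a|%:Z
    + #|T|%:Z ^+ 2.
  by rewrite -mulnn !PoszM; ring.
under eq_bigr do under eq_bigr do rewrite devE.
under eq_bigr do rewrite big_split sumrB /= -!mulr_sumr sumr_const.
rewrite big_split sumrB /= -!mulr_sumr sumr_const card_unity_roots.
under [X in _ * X - _]eq_bigr do rewrite -(big_morph Posz PoszD (erefl _)).
under [X in _ - _ * X]eq_bigr do rewrite -(big_morph Posz PoszD (erefl _)).
rewrite -!(big_morph Posz PoszD (erefl _)) sum_shifted_class.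
have := sum_sqr_shifted_class_le; rewrite cardF -mulrnA -mulr_natr natz.
move: e_gt0 f_gt0; move: (\sum_(c in _) _)%N #|T| => S x; move: e f; clear => e f e0 f0.
rewrite -mulnn -lez_nat !(PoszD, PoszM) -subzn // => S_le.
rewrite -subr_ge0 -(addn1 (e * f)) !(PoszD, PoszM).
set gap := (X in 0 <= X).
have -> : gap = e%:Z ^+ 2 * (x%:Z * (e%:Z * f%:Z) + x%:Z * x%:Z * (f%:Z - 1) - S%:Z) +
    (e%:Z ^+ 3 * x%:Z * f%:Z + 2 * e%:Z ^+ 2 * x%:Z + e%:Z * x%:Z ^+ 2 * (e%:Z - 1)).
  by rewrite /gap; ring.
have e1 : 0 <= e%:Z - 1 by lia.
by rewrite !addr_ge0 ?mulr_ge0 ?exprn_ge0 // subr_ge0.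
Qed.

Lemma card_sparse_shifts_le c : c \in unity_roots ->
  (#|[set a | 2 * e * #|shifted_class c a| < #|T|]| * #|T| <= 8 * e ^ 2 * #|F|)%N.
Proof.
move=> cR; have [->|T_gt0] := posnP #|T|; first by rewrite muln0.
rewrite -(leq_pmul2r T_gt0) -mulnA mulnn -lez_nat.
under eq_finset do rewrite -mulnA.
apply: le_trans (chebyshev_half (fun a => e * #|shifted_class c a|)%N #|T|) _.
have -> : Posz (8 * e ^ 2 * #|F| * #|T|) = 4 * (2 * e ^ 2 * #|T| * #|F|)%:Z.
  by rewrite !PoszM; ring.
rewrite ler_wpM2l //; apply: le_trans sum_deviation_le; rewrite [leRHS](bigD1 c) //=.
by apply: ler_wpDr => //; apply: sumr_ge0 => c' _; apply: sumr_ge0 => a _; apply: sqr_ge0.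
Qed.
End SecondMoment.
End PowerResidues.

(** * Difference families over finite fields *)

Lemma exists_avoiding (T : finType) n (A : {set T}) (bad : 'I_n -> {set T}) B :
  (forall i, #|bad i| <= B) -> n * B < #|A| -> exists2 a, a \in A & forall i, a \notin bad i.
Proof.
move=> bad_le A_gt; have /subsetPn [a aA a_good] : ~~ (A \subset \bigcup_i bad i).
  apply: contraL A_gt => /subset_leq_card A_le; rewrite -leqNgt; apply: leq_trans A_le _.
  apply: (@leq_trans (\sum_i #|bad i|)).
    elim/big_rec2: _ => [|i N U _ U_le]; first by rewrite cards0.
    by apply: leq_trans (leq_card_setU _ _) _; rewrite leq_add2l.
  by rewrite -[n in leqRHS]card_ord -sum_nat_const; apply: leq_sum => i _; apply: bad_le.
by exists a => // i; apply: contra a_good => ai; apply/bigcupP; exists i.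
Qed.

(* Choose [a 0], [a 1], ... greedily: all but boundedly many choices of [a 0] keep a
   positive proportion of the candidates for every later term. *)
Lemma prescribed_power_classes_from (e k K : nat) : 0 < e ->
  exists q0, forall (F : finFieldType) (f : nat), 0 < f -> #|F| = (e * f).+1 -> q0 <= #|F| ->
  forall (T : nat -> {set F}) (c : nat -> nat -> F),
    (forall i, i < k -> #|F| <= K * #|T i|) ->
    (forall i j, i < k -> j < k -> c i j \in unity_roots F e) ->
  exists a : nat -> F, (forall i, i < k -> a i \in T i) /\
    (forall i j, i < j -> j < k -> ((a j - a i) ^+ f)%R = c i j).
Proof.
move=> e_gt0; elim: k K => [|k IHk] K.
  by exists 0 => F f _ _ _ T c _ _; exists (fun=> 0%R).
have [q1 IH] := IHk (2 * e * K).
exists (q1 + (K * (k * (8 * e ^ 2 * K))).+1) => F f f_gt0 cardF F_ge T c TK cR.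
pose bad i := [set a : F | 2 * e * #|shifted_class f (T i) (c 0 i) a| < #|T i|].
have bad_le i : i < k.+1 -> #|bad i| <= 8 * e ^ 2 * K.
  move=> ik; have T_gt0 : 0 < #|T i|.
    by have := TK i ik; rewrite cardF; case: #|T i| => //; rewrite muln0.
  rewrite -(leq_pmul2r T_gt0).
  apply: leq_trans (card_sparse_shifts_le e_gt0 f_gt0 cardF (T i) (cR 0 i isT ik)) _.
  by rewrite -[leqRHS]mulnA leq_mul2l TK // orbT.
have [||a0 a0T a0_good] := @exists_avoiding F k (T 0) (fun i => bad i.+1) (8 * e ^ 2 * K).
- by move=> i; apply: bad_le; rewrite ltnS.
- have := leq_trans F_ge (TK 0 isT); rewrite addnS => KT.
  by have := leq_ltn_trans (leq_addl q1 _) KT; rewrite ltn_mul2l => /andP[].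
have [|i ik|i j ik jk|a [aT ac]] := IH F f f_gt0 cardF _
    (fun i => shifted_class f (T i.+1) (c 0 i.+1) a0) (fun i j => c i.+1 j.+1).
- by apply: leq_trans F_ge; rewrite leq_addr.
- have := a0_good (Ordinal ik); rewrite inE -leqNgt => class_ge; apply: leq_trans (TK i.+1 ik) _.
  by rewrite [2 * e * K]mulnC -[leqRHS]mulnA leq_mul2l class_ge orbT.
- exact: cR.
exists (fun i => if i is i'.+1 then a i' else a0); split=> [[|i] ik //|[|i] [|j] ij jk //].
- by have := aT i ik; rewrite inE => /andP[].
- by have := aT j jk; rewrite inE => /andP[_ /eqP].
- exact: ac.
Qed.

Lemma prescribed_power_classes (e k : nat) : 0 < e ->
  exists q0, forall (F : finFieldType) (f : nat), 0 < f -> #|F| = (e * f).+1 -> q0 <= #|F| ->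
  forall c : 'I_k -> 'I_k -> F, (forall i j, c i j \in unity_roots F e) ->
  exists a : 'I_k -> F, forall i j : 'I_k, i < j -> ((a j - a i) ^+ f)%R = c i j.
Proof.
move=> e_gt0; case: k => [|k]; first by exists 0 => F f _ _ _ c _; exists (fun=> 0%R) => -[].
have [q0 q0P] := prescribed_power_classes_from k.+1 1 e_gt0.
exists q0 => F f f_gt0 cardF F_ge c cR.
have [i _|i j _ _|a [_ aE]] := q0P F f f_gt0 cardF F_ge (fun=> setT)
  (fun i j => c (inord i) (inord j)).
- by rewrite cardsT mul1n.
- exact: cR.
- by exists (fun i => a i) => i j ij; rewrite aE // !inord_val.
Qed.

Lemma exists_negation_half (F : finFieldType) : odd #|F| ->
  exists H : {set F}, forall x : F, x != 0%R -> (x \in H) + (- x \in H)%R = 1.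
Proof.
move=> F_odd; exists [set x | enum_rank x < enum_rank (- x)%R] => x x0.
rewrite !inE opprK; case: ltngtP => // /val_inj/enum_rank_inj xN.
have F_card0 : (1 *+ #|F| = 0 :> F)%R.
  by have := @expg_cardG _ [set: F]%G (1%R : F) (in_setT _); rewrite cardsT.
have two0 : (1 *+ 2 = 0 :> F)%R.
  by apply/eqP; rewrite -(mulIr_eq0 _ (mulIf x0)) mulr_natl mulr2n {1}xN addNr.
move: F_card0; rewrite -(odd_double_half #|F|) F_odd mulrnDr -mul2n mulrnA two0 mul0rn addr0.
by move/eqP; rewrite oner_eq0.
Qed.

Lemma count_affine_maps (F : finFieldType) (H : {set F}) (u v x y : F) : u != v ->
  \sum_(hc : {h | h \in H} * F)
    ((val hc.1 * u + hc.2 == x)%R && (val hc.1 * v + hc.2 == y)%R) = ((x - y) / (u - v) \in H)%R.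
Proof.
move=> nuv; have d0 : (u - v != 0)%R by rewrite subr_eq0.
pose h0 := ((x - y) / (u - v))%R; rewrite -/h0.
have uniq_map (h c : F) :
    ((h * u + c == x) && (h * v + c == y))%R = (h == h0) && (c == x - h0 * u)%R.
  apply/andP/andP => -[/eqP eq1 /eqP eq2].
    have hh0 : h = h0 by apply: (mulIf d0); rewrite mulfVK // -eq1 -eq2; ring.
    by split; apply/eqP => //; rewrite -hh0 -eq1; ring.
  have : (h0 * (u - v) = x - y)%R by rewrite mulfVK.
  by rewrite eq1 eq2 => h0E; split; apply/eqP; [ring | rewrite -[RHS](subKr x) -h0E; ring].
under eq_bigr do rewrite uniq_map.
have [h0H|h0H] := boolP (h0 \in H).
  rewrite (bigD1 (Sub h0 h0H, x - h0 * u)%R) //= !eqxx big1 // => -[h c] /=.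
  by rewrite xpair_eqE -val_eqE /= => /negbTE ->.
by apply: big1 => -[h c] _ /=; case: eqP => // hh0; have := valP h; rewrite /= hh0 (negbTE h0H).
Qed.

Section FieldDesign.
Variables (k : nat) (C : finType) (col : 'I_k -> 'I_k -> C) (mu : C -> nat) (e l : nat).
Hypothesis col_sym : forall p q, col p q = col q p.
Hypotheses (e_gt0 : 0 < e) (muE : forall c, e * mu c = l * #|col_pairs col c|).

Lemma exists_base_blocks : exists q0, forall (F : finFieldType) (f : nat),
  0 < f -> #|F| = (e * f).+1 -> q0 <= #|F| ->
  exists a : 'I_(2 * l) -> 'I_k -> F, (forall t, injective (a t)) /\
    forall c v, v \in unity_roots F e ->
      \sum_t \sum_(p in col_edges col c) ((a t p.2 - a t p.1) ^+ f == v)%R = mu c.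
Proof.
have [q0 q0P] := prescribed_power_classes k e_gt0.
exists q0 => F f f_gt0 cardF F_ge; pose R := {v : F | v \in unity_roots F e}.
have cardR : #|{: R}| = e.
  by rewrite card_sig -[RHS](card_unity_roots e_gt0 f_gt0 cardF); apply: eq_card.
pose P c : {set 'I_(2 * l) * ('I_k * 'I_k)} := [set x | x.2 \in col_edges col c].
have one_root : 1%R \in unity_roots F e by rewrite inE expr1n.
have /choice [g gE] : forall c, exists g : 'I_(2 * l) * ('I_k * 'I_k) -> R,
    forall v, #|[set x in P c | g x == v]| = mu c.
  move=> c; apply: (uniform_coloring (Sub 1%R one_root : R)); rewrite cardR muE card_col_pairs //.
  rewrite mulnA [l * 2]mulnC -[2 * l in RHS]card_ord -cardX; apply: eq_card => x.
  by rewrite !inE.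
have /choice [a aE] : forall t, exists a : 'I_k -> F, forall i j : 'I_k, i < j ->
    ((a j - a i) ^+ f)%R = val (g (col i j) (t, (i, j))).
  by move=> t; apply: (q0P F f f_gt0 cardF F_ge) => i j; apply: valP.
exists a; split=> [t i j aij|c v vR].
  apply: val_inj; case: (ltngtP i j) => // ij.
    have := unity_roots_neq0 e_gt0 (valP (g (col i j) (t, (i, j)))).
    by rewrite -aE // aij subrr expr0n eqn0Ngt f_gt0 eqxx.
  have := unity_roots_neq0 e_gt0 (valP (g (col j i) (t, (j, i)))).
  by rewrite -aE // aij subrr expr0n eqn0Ngt f_gt0 eqxx.
rewrite -(gE c (Sub v vR)) -sum1dep_card pair_big_dep /= big_mkcond [RHS]big_mkcond /=.
apply: eq_bigr => -[t [i j]] _; rewrite !inE /=; case: andP => //= -[ij /eqP cij].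
by rewrite aE // cij -val_eqE; case: (_ == _).
Qed.

(* The base blocks are multiplied by half of the [f]-th roots of unity, one of each
   pair [h, -h], and translated by [F]. *)
Lemma has_design_field : exists q0, forall F : finFieldType, q0 <= #|F| ->
  2 * e %| #|F| - 1 -> has_design col mu #|F|.
Proof.
have [q0 q0P] := exists_base_blocks; exists q0 => F F_ge /dvdnP [g gE].
have F_gt1 := finNzRing_gt1 F; pose f := 2 * g.
have cardF : #|F| = (e * f).+1.
  by rewrite -[LHS](subnK (ltnW F_gt1)) gE addn1 /f; congr _.+1; ring.
have f_gt0 : 0 < f by move: F_gt1; rewrite cardF ltnS muln_gt0 => /andP[].
have F_odd : odd #|F| by rewrite cardF /= mulnCA oddM.
have exprN (x : F) : ((- x) ^+ f = x ^+ f)%R by rewrite /f !exprM sqrrN.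
have [a [a_inj aE]] := q0P F f f_gt0 cardF F_ge.
have [half halfP] := exists_negation_half F_odd.
pose H := [set h in half | (h ^+ f == 1)%R].
pose B (j : 'I_(2 * l) * ({h | h \in H} * F)) p : F := (val j.2.1 * a j.1 p + j.2.2)%R.
rewrite (has_design_card _ _ (erefl #|F|)); exists _, B => c x y.
rewrite -(pair_bigA _ (fun t hc => edge_mult col (B (t, hc)) c x y)) /=.
have ratio_neq t p q : p != q -> a t p != a t q by rewrite (inj_eq (@a_inj t)).
transitivity (\sum_t \sum_(p in col_pairs col c) ((x - y) / (a t p.1 - a t p.2) \in H)%R).
  apply: eq_bigr => t _; rewrite exchange_big /=; apply: eq_bigr => p /andP[npq _].
  by rewrite -count_affine_maps ?ratio_neq.
have [<-|nxy] := eqVneq x y.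
  rewrite muln0 big1 // => t _; rewrite big1 // => p _.
  by rewrite subrr mul0r !inE expr0n eqn0Ngt f_gt0 eq_sym oner_eq0 andbF.
rewrite muln1 -(aE c ((x - y) ^+ f)%R); last by apply: (expr_unity_roots cardF); rewrite subr_eq0.
apply: eq_bigr => t _.
rewrite (big_offdiag addn (P := fun p q => col p q == c)
  (fun p q => ((x - y) / (a t p - a t q) \in H)%R : nat) val_inj); last first.
  by move=> p q; rewrite col_sym.
apply: eq_bigr => -[p q] /= /andP[pq _].
have npq : p != q by rewrite -val_eqE /= neq_ltn pq.
have d0 : (a t p - a t q != 0)%R by rewrite subr_eq0 ratio_neq.
set h := (_ / _)%R; have -> : ((x - y) / (a t q - a t p) = - h)%R.
  by rewrite -[(a t q - _)%R]opprB invrN mulrN.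
rewrite !inE exprN.
have -> : (h ^+ f == 1)%R = ((a t q - a t p) ^+ f == (x - y) ^+ f)%R.
  rewrite -exprN opprB expr_div_n -(inj_eq (mulIf (expf_neq0 f d0))).
  by rewrite mulfVK ?expf_neq0 // mul1r eq_sym.
case: (_ == _); rewrite ?andbF // !andbT; apply: halfP.
by rewrite mulf_neq0 ?invr_eq0 // subr_eq0.
Qed.
End FieldDesign.

(** * Transversal designs *)

(* [phi i w] is the point in which the block [w] meets the group [i]. *)
Definition is_TD (k : nat) (Z W : finType) (phi : 'I_k -> W -> Z) : Prop :=
  forall i j, i != j -> bijective (fun w => (phi i w, phi j w)).

Definition has_TD k n := exists (W : finType) (phi : 'I_k -> W -> 'I_n), is_TD phi.

Lemma has_TD_card k n (Z W : finType) (phi : 'I_k -> W -> Z) :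
  #|Z| = n -> is_TD phi -> has_TD k n.
Proof.
move=> <- td; exists W, (fun i w => enum_rank (phi i w)) => i j nij.
apply: (bij_comp (f := fun x => (enum_rank x.1, enum_rank x.2))) (td i j nij).
by exists (fun x => (enum_val x.1, enum_val x.2)) => -[x y]; rewrite /= ?enum_rankK ?enum_valK.
Qed.

Lemma has_TD_leq k l n : k <= l -> has_TD l n -> has_TD k n.
Proof.
by move=> kl [W [phi td]]; exists W, (fun i => phi (widen_ord kl i)) => i j nij; apply: td.
Qed.

Lemma has_TD1 k : has_TD k 1.
Proof.
exists 'I_1, (fun _ _ => ord0) => i j _.
by exists (fun=> ord0) => [w|[x y]]; rewrite ?[w]ord1 ?[x]ord1 ?[y]ord1.
Qed.

Lemma has_TD_mul k a b : has_TD k a -> has_TD k b -> has_TD k (a * b).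
Proof.
move=> [W1 [phi1 td1]] [W2 [phi2 td2]].
apply: (@has_TD_card _ _ ('I_a * 'I_b)%type (W1 * W2)%type (fun i w => (phi1 i w.1, phi2 i w.2))).
  by rewrite card_prod !card_ord.
move=> i j nij; have [g1 phi1K g1K] := td1 i j nij; have [g2 phi2K g2K] := td2 i j nij.
exists (fun x => (g1 (x.1.1, x.2.1), g2 (x.1.2, x.2.2))) => [[w1 w2]|[[x1 x2] [y1 y2]]] /=.
  by rewrite phi1K phi2K.
by have [-> ->] := g1K (x1, y1); have [-> ->] := g2K (x2, y2).
Qed.

Lemma has_TD_field k (F : finFieldType) : k <= #|F| -> has_TD k #|F|.
Proof.
move=> kF; have [|d d_inj] := @exists_injection 'I_k F; first by rewrite card_ord.
apply: (@has_TD_card _ _ F (F * F)%type (fun i w => w.1 + d i * w.2)%R) => // i j nij.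
have dij : (d i - d j != 0)%R by rewrite subr_eq0 (inj_eq d_inj).
exists (fun x => (x.1 - d i * ((x.1 - x.2) / (d i - d j)), (x.1 - x.2) / (d i - d j))%R);
  by move=> [x y] /=; congr pair; field.
Qed.

Lemma has_TD_MacNeish k n :
  0 < n -> (forall p, prime p -> p %| n -> k <= p ^ logn p n) -> has_TD k n.
Proof.
elim/ltn_ind: n => n IH n_gt0 k_le; have [n_le1|n_gt1] := leqP n 1.
  by rewrite (_ : n = 1); [exact: has_TD1 | lia].
have [p p_pr p_n] : exists2 p, prime p & p %| n by exists (pdiv n); rewrite ?pdiv_prime ?pdiv_dvd.
have [m p_m nE] := pfactor_coprime p_pr n_gt0.
have logn_gt0 : 0 < logn p n by rewrite logn_gt0 mem_primes p_pr n_gt0.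
have part_gt1 : 1 < p ^ logn p n by rewrite -(expn0 p) ltn_exp2l // prime_gt1.
have m_gt0 : 0 < m by move: n_gt0; rewrite nE muln_gt0 => /andP[].
rewrite nE; apply: has_TD_mul; last first.
  have [F _ cardF] := pPrimePowerField p_pr logn_gt0.
  by rewrite -cardF; apply: has_TD_field; rewrite cardF k_le.
apply: IH => // [|r r_pr r_m]; first by rewrite nE -[ltnLHS]muln1 ltn_pmul2l.
have npr : p != r by apply: contraTneq p_m => ->; rewrite prime_coprime // negbK.
have -> : logn r m = logn r n; last by apply: k_le; rewrite // nE dvdn_mulr.
rewrite [n in RHS]nE (lognM _ m_gt0 (ltnW part_gt1)) lognX.
by rewrite [logn r p]logn_prime // eq_sym (negbTE npr) muln0 addn0.
Qed.

Lemma leq_prime_part p n : prime p -> 0 < n -> p %| n -> p <= p ^ logn p n.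
Proof.
move=> p_pr n_gt0 p_n; rewrite -{1}(expn1 p) leq_exp2l ?prime_gt1 //.
by rewrite logn_gt0 mem_primes p_pr n_gt0.
Qed.

Lemma has_TD_coprime k n : 0 < n -> coprime n k`! -> has_TD k n.
Proof.
move=> n_gt0 n_k; apply: has_TD_MacNeish => // p p_pr p_n.
apply: leq_trans (leq_prime_part p_pr n_gt0 p_n); apply: ltnW.
have := coprime_dvdl p_n n_k; rewrite prime_coprime // ltnNge; apply: contra => pk.
by apply: dvdn_fact; rewrite prime_gt0.
Qed.

Lemma has_TD_fact_dvd k n : 0 < n -> k`! ^ k %| n -> has_TD k n.
Proof.
move=> n_gt0 fact_n; apply: has_TD_MacNeish => // p p_pr p_n; have [kp|pk] := ltnP k p.
  exact: leq_trans (ltnW kp) (leq_prime_part p_pr n_gt0 p_n).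
have p_fact : p %| k`! by apply: dvdn_fact; rewrite prime_gt0.
have : p ^ k %| n by apply: dvdn_trans fact_n; apply: dvdn_exp2r.
rewrite pfactor_dvdn // => k_le; apply: leq_trans (ltnW (ltn_expl k (prime_gt1 p_pr))) _.
by rewrite leq_exp2l ?prime_gt1.
Qed.

(** * Transversal designs as ingredients *)

Section TransversalBlocks.
Variables (k x : nat) (W P : finType) (phi : 'I_k -> W -> 'I_x).
Variables (grp : P -> 'I_k) (pos : P -> 'I_x).

Definition td_block (w : W) : {set P} := [set p | phi (grp p) w == pos p].

Definition partial_linear (J : Type) (A : J -> {set P}) := forall j j' p q,
  p != q -> p \in A j -> q \in A j -> p \in A j' -> q \in A j' -> j = j'.

Definition collinear (J : finType) (A : J -> {set P}) : rel P :=
  fun p q => (p != q) && [exists j, (p \in A j) && (q \in A j)].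

Lemma fiber_partial_linear : partial_linear (fun i => [set p | grp p == i]).
Proof. by move=> i i' p q _; rewrite !inE => /eqP <- _ /eqP. Qed.

Lemma fiber_collinear p q :
  collinear (fun i => [set p | grp p == i]) p q = (p != q) && (grp p == grp q).
Proof.
congr (_ && _); apply/existsP/eqP => [[i]|pq]; first by rewrite !inE => /andP[/eqP -> /eqP].
by exists (grp p); rewrite !inE pq eqxx.
Qed.

Hypothesis phi_td : is_TD phi.
Hypothesis grp_pos_inj : injective (fun p => (grp p, pos p)).

Lemma td_block_grp_inj w : {in td_block w &, injective grp}.
Proof.
move=> p q; rewrite !inE => /eqP pw /eqP qw pq; apply: grp_pos_inj.
by rewrite -pw -qw pq.
Qed.

Lemma td_block_partial_linear : partial_linear td_block.
Proof.
move=> w w' p q npq pw qw; have ngrp : grp p != grp q.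
  by apply: contra npq => /eqP pq; apply/eqP; apply: (td_block_grp_inj pw qw).
move: pw qw; rewrite !inE => /eqP pw /eqP qw /eqP pw' /eqP qw'.
by apply: (bij_inj (phi_td ngrp)); rewrite pw qw pw' qw'.
Qed.

Lemma td_block_collinear p q : collinear td_block p q = (grp p != grp q).
Proof.
apply/andP/idP => [[npq /existsP[w /andP[pw qw]]]|ngrp].
  by apply: contra npq => /eqP pq; apply/eqP; apply: (td_block_grp_inj pw qw).
split; first by apply: contraNneq ngrp => ->.
have [g _ gK] := phi_td ngrp; apply/existsP; exists (g (pos p, pos q)).
by have := gK (pos p, pos q); rewrite !inE => -[-> ->]; rewrite !eqxx.
Qed.
End TransversalBlocks.

Lemma fst_snd_inj (A B : Type) : injective (fun p : A * B => (p.1, p.2)).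
Proof. by move=> [? ?] [? ?]. Qed.

Lemma card_graph (A B : finType) (h : A -> B) : #|[pred x : A * B | h x.1 == x.2]| = #|A|.
Proof.
have graph_inj : injective (fun a => (a, h a)) by move=> a a' [].
rewrite -(card_image graph_inj); apply: eq_card => -[a b]; rewrite inE /=.
by apply/eqP/imageP => [<-|[a' _ [-> ->]] //]; exists a.
Qed.

Lemma card_pred_sum (A B : finType) (Q : pred (A + B)) :
  #|Q| = #|[pred a | Q (inl a)]| + #|[pred b | Q (inr b)]|.
Proof. by rewrite -!sum1_card big_sumType. Qed.

Lemma card_td_block (m x : nat) (W : finType) (phi : 'I_m -> W -> 'I_x) w :
  #|td_block phi (@fst 'I_m 'I_x) snd w| = m.
Proof. by rewrite cardsE (card_graph (fun i => phi i w)) card_ord. Qed.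

Section Closure.
Variables (k : nat) (C : finType) (col : 'I_k -> 'I_k -> C) (mu : C -> nat).
Local Notation decomposable := (decomposable col mu).
Local Notation has_GDD := (has_GDD col mu).
Local Notation has_design := (has_design col mu).
Local Notation has_holey_design := (has_holey_design col mu).

Lemma decomposable_collinear (P J : finType) g (A : J -> {set P}) :
  (forall j, has_GDD g #|A j|) -> partial_linear A ->
  decomposable (fun x y : P * 'I_g => collinear A x.1 y.1).
Proof.
move=> A_gdd A_lin; pose rA j (x y : P * 'I_g) := [&& x.1 != y.1, x.1 \in A j & y.1 \in A j].
apply: (@decomposable_sum _ _ _ _ _ _ rA) => [j|x y].
  have := A_gdd j.
  move=> /(@has_GDD_card _ _ _ _ {p | p \in A j} 'I_g _ _ (card_ord g) (card_sig (mem (A j)))).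
  apply: (@decomposable_embed _ _ _ _ _ _ (fun a => (val a.1, a.2))).
  - by move=> [a u] [b v] [/val_inj -> ->].
  - move=> [[p pA] u] [[q qA] v]; rewrite /rA /= pA qA !andbT.
    by rewrite -[in RHS]val_eqE.
  move=> [p u] [q v] /and3P[/= _ pA qA].
  by apply/andP; split; apply/codomP;
    [exists (exist _ p pA, u) | exists (exist _ q qA, v)].
rewrite /collinear; have [xy|nxy] := eqVneq x.1 y.1.
  by rewrite big1 // => j _; rewrite /rA xy eqxx.
rewrite /=; case: existsP => [[j /andP[xj yj]]|no_block].
  rewrite (bigD1 j) //= /rA nxy xj yj big1 // => j' nj; apply/eqP; rewrite eqb0.
  by apply: contra nj => /and3P[_ xj' yj']; apply/eqP; apply: (A_lin _ _ x.1 y.1).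
rewrite big1 // => j _; apply/eqP; rewrite eqb0 /rA nxy.
by apply/negP => xyj; apply: no_block; exists j.
Qed.

Lemma decomposable_collinear1 (P J : finType) (A : J -> {set P}) :
  (forall j, has_design #|A j|) -> partial_linear A -> decomposable (collinear A).
Proof.
move=> A_design A_lin.
have fst_bij : bijective (@fst P 'I_1).
  by exists (fun p => (p, ord0)) => // -[p u]; rewrite [u]ord1.
apply/(decomposable_iso (rY := fun x y => collinear A x.1 y.1) _ _ fst_bij (fun _ _ => erefl)).
by apply: decomposable_collinear => // j; apply/has_GDD1.
Qed.

Lemma has_GDD_weight g m x : has_TD m x -> has_GDD g m -> has_GDD (x * g) m.
Proof.
move=> [W [phi td]] gdd; have blocks_lin := td_block_partial_linear td (@fst_snd_inj 'I_m 'I_x).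
apply: (@has_GDD_assoc _ _ _ _ 'I_m 'I_x 'I_g); rewrite ?card_ord //.
apply: decomposable_eq (decomposable_collinear _ blocks_lin) => [a b|w].
  exact: td_block_collinear td (@fst_snd_inj _ _) _ _.
by rewrite card_td_block.
Qed.

Lemma has_holey_design_set (X : finType) (A : {set X}) :
  decomposable (fun x y => (x != y) && ~~ ((x \in A) && (y \in A))) ->
  has_holey_design #|~: A| #|A|.
Proof.
pose f (a : {x | x \in ~: A} + {x | x \in A}) := match a with inl a => val a | inr a => val a end.
have fA a : (f a \in A) = (if a is inr _ then true else false).
  by case: a => -[x] //=; rewrite inE => /negbTE.
have f_inj : injective f.
  move=> a b ab; move: (fA a); rewrite ab fA; case: a b ab => [a|a] [b|b] //= ab _;
  by congr (_ _); apply: val_inj.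
have f_bij : bijective f.
  by apply: inj_card_bij f_inj _; rewrite card_sum !card_sig addnC cardsC.
move=> dec; apply/(has_holey_design_card _ _ (Z := {x | x \in ~: A}) (H := {x | x \in A}));
  rewrite ?card_sig //; apply: (decomposable_iso _ _ f_bij _).2 dec => a b.
by rewrite (inj_eq f_inj) !fA /hole_rel; case: a b => [?|?] [?|?]; rewrite ?andbT ?andbF.
Qed.

(* Remove one block of a transversal design with [n] groups of size [x]. *)
Lemma has_holey_design_TD n x : 1 < n -> 0 < x -> has_TD n x ->
  has_design n -> has_design x -> has_holey_design (n * x - n) n.
Proof.
move=> n_gt1 x_gt0 [W [phi td]] design_n design_x.
have [g _ _] := td (Ordinal (ltnW n_gt1)) (Ordinal n_gt1) isT.
pose w0 := g (Ordinal x_gt0, Ordinal x_gt0).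
pose A := td_block phi (@fst 'I_n 'I_x) snd.
have <- : #|~: A w0| = n * x - n by rewrite cardsCs setCK card_td_block card_prod !card_ord.
rewrite -[X in has_holey_design _ X](card_td_block phi w0); apply: has_holey_design_set.
apply: (decomposable_classes (cl := fun p q => p.1 == q.1)) => -[].
  apply: decomposable_eq (decomposable_collinear1 _ (@fiber_partial_linear _ _ fst)) => [p q|i].
    rewrite fiber_collinear andbC; case: eqVneq => //= pq_grp; case: eqVneq => //= npq.
    apply/esym/negP => /andP[pA qA]; case/eqP: npq.
    exact: (td_block_grp_inj (@fst_snd_inj _ _) pA qA).
  by rewrite cardsE card_fst_fiber card_ord.
apply: decomposable_eq (@decomposable_collinear1 _ {w | w != w0} (fun w => A (val w)) _ _).
- move=> p q; rewrite eqbF_neg -(td_block_collinear td (@fst_snd_inj _ _)) -/A /collinear.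
  case: eqVneq => //= npq; apply/existsP/andP => [[w pqw]|[/existsP[w pqw] pq0]].
    split; first by apply/existsP; exists (val w).
    apply/negP => /andP[p0 q0]; case/andP: pqw => pw qw; have /eqP := valP w; case.
    exact: (td_block_partial_linear td (@fst_snd_inj _ _) npq).
  by have ww0 : w != w0 by [apply: contraNneq pq0 => <-]; exists (exist _ w ww0).
- by move=> w; rewrite card_td_block.
- move=> w w' p q npq pw qw pw' qw'.
  exact/val_inj/(td_block_partial_linear td (@fst_snd_inj _ _) npq).
Qed.
End Closure.

(** * Truncated transversal designs *)

Section Truncated.
Variables (K x y : nat) (yx : y <= x).
Local Notation pts := ('I_K * 'I_x + 'I_y)%type.

Definition trunc_grp (p : pts) : 'I_K.+1 :=
  match p with inl q => lift ord_max q.1 | inr _ => ord_max end.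

Definition trunc_pos (p : pts) : 'I_x :=
  match p with inl q => q.2 | inr u => widen_ord yx u end.

Lemma trunc_grp_pos_inj : injective (fun p => (trunc_grp p, trunc_pos p)).
Proof.
case=> [[i z]|u] [[i' z']|u'] /= /eqP; rewrite xpair_eqE.
- by rewrite (inj_eq (@lift_inj _ _)) => /andP[/eqP -> /eqP ->].
- by rewrite eq_sym (negbTE (neq_lift _ _)).
- by rewrite (negbTE (neq_lift _ _)).
- by move=> /andP[_ /eqP/(congr1 val)/= /val_inj ->].
Qed.

Lemma card_trunc_fiber i :
  #|[pred p | trunc_grp p == i]| = if i == ord_max then y else x.
Proof.
rewrite card_pred_sum /=; case: (unliftP ord_max i) => [j|] ->.
  rewrite [lift _ _ == ord_max]eq_sym (negbTE (neq_lift _ _)).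
  have -> : #|[pred p : 'I_K * 'I_x | lift ord_max p.1 == lift ord_max j]| = x.
    rewrite -[RHS]card_ord -(card_fst_fiber _ j); apply: eq_card => q.
    by rewrite !inE (inj_eq (@lift_inj _ _)).
  by rewrite (eq_card0 (A := [pred: 'I_y | false])) // addn0.
rewrite eqxx (eq_card0 (A := [pred p : 'I_K * 'I_x | _])) => [|p].
  by rewrite -[RHS]card_ord; apply: eq_card => u; rewrite !inE.
by apply/negbTE; rewrite inE /= eq_sym neq_lift.
Qed.

Lemma card_trunc_block (W : finType) (phi : 'I_K.+1 -> W -> 'I_x) w :
  #|td_block phi trunc_grp trunc_pos w| = K \/ #|td_block phi trunc_grp trunc_pos w| = K.+1.
Proof.
rewrite cardsE card_pred_sum /= (card_graph (fun i => phi (lift ord_max i) w)) card_ord.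
have : #|[pred u : 'I_y | phi ord_max w == widen_ord yx u]| <= 1.
  apply/card_le1_eqP => u v; rewrite !inE => /eqP -> /eqP /(congr1 val) /= uv.
  exact: val_inj.
by case: #|_| => [|[]] // _; [left; rewrite addn0 | right; rewrite addn1].
Qed.
End Truncated.

Section Assembly.
Variables (k : nat) (C : finType) (col : 'I_k -> 'I_k -> C) (mu : C -> nat).
Local Notation decomposable := (decomposable col mu).
Local Notation has_GDD := (has_GDD col mu).
Local Notation has_design := (has_design col mu).
Local Notation has_holey_design := (has_holey_design col mu).

Lemma decomposable_trunc g K x y : y <= x -> has_TD K.+1 x -> has_GDD g K -> has_GDD g K.+1 ->
  decomposable (fun a b : ('I_K * 'I_x + 'I_y) * 'I_g => trunc_grp a.1 != trunc_grp b.1).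
Proof.
move=> yx [W [phi td]] gddK gddK1.
have blocks_lin := td_block_partial_linear td (trunc_grp_pos_inj (yx := yx)).
apply: decomposable_eq (decomposable_collinear _ blocks_lin) => [a b|w].
  exact: td_block_collinear td (trunc_grp_pos_inj (yx := yx)) _ _.
by case: (card_trunc_block yx phi w) => ->.
Qed.

Lemma has_GDD_trunc g K x y : y <= x -> has_TD K.+1 x ->
  has_GDD g K -> has_GDD g K.+1 -> has_GDD g x -> has_GDD g y -> has_GDD g (K * x + y).
Proof.
move=> yx td gddK gddK1 gddx gddy.
apply/(has_GDD_card _ _ (P := ('I_K * 'I_x + 'I_y)%type) (U := 'I_g));
  rewrite ?card_sum ?card_prod ?card_ord //.
apply: (decomposable_classes (cl := fun a b => trunc_grp a.1 == trunc_grp b.1)) => -[].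
  have fibers_lin := fiber_partial_linear (grp := @trunc_grp K x y).
  apply: decomposable_eq (decomposable_collinear _ fibers_lin) => [a b|i].
    by rewrite fiber_collinear eqb_id andbC.
  by rewrite cardsE card_trunc_fiber; case: ifP.
apply: decomposable_eq (decomposable_trunc yx td gddK gddK1) => a b.
rewrite eqbF_neg; case: (eqVneq (trunc_grp a.1)) => //= ab.
by apply/esym; apply: contraNneq ab => ->.
Qed.

(* Write [m = K x + y] with [x = 1] modulo [(K + 1)!] and [K <= y <= x]; the bound on
   the base cases is what makes [y <= x]. *)
Lemma has_GDD_of_interval g K : 0 < K ->
  (forall m, K <= m <= 2 * K + 2 * K * (K * (K.+1)`!) -> has_GDD g m) ->
  forall m, K <= m -> has_GDD g m.
Proof.
move=> K_gt0 base m; elim/ltn_ind: m => m IH Km.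
have [m_le|m_gt] := leqP m (2 * K + 2 * K * (K * (K.+1)`!)); first by apply: base; rewrite Km.
pose P := (K.+1)`!; have P_gt0 : 0 < P by apply: fact_gt0.
have KP_gt0 : 0 < K * P by rewrite muln_gt0 K_gt0.
pose t := (m - 2 * K) %/ (K * P); pose y := K + (m - 2 * K) %% (K * P); pose x := 1 + P * t.
have mE : m = K * x + y.
  have := divn_eq (m - 2 * K) (K * P); rewrite -/t /x /y.
  have -> : K * (1 + P * t) = K + t * (K * P) by ring.
  lia.
have t_ge : 2 * K <= t by rewrite /t leq_divRL // -/P; lia.
have r_lt : (m - 2 * K) %% (K * P) < K * P by rewrite ltn_mod.
have yx : y <= x.
  have : P * (2 * K) <= P * t by rewrite leq_mul2l t_ge orbT.
  rewrite /y /x; nia.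
have Kx : K <= x by apply: leq_trans yx; rewrite leq_addr.
have td : has_TD K.+1 x.
  by apply: has_TD_coprime; rewrite // /x -/P coprime_sym /coprime mulnC addnC gcdnMDl gcdn1.
rewrite mE; apply: has_GDD_trunc => //.
- by apply: base; nia.
- by apply: base; nia.
- by apply: IH => //; nia.
- by apply: IH; rewrite ?leq_addr //; nia.
Qed.

Lemma has_design_assemble K D x y n : y <= x -> has_TD K.+1 x ->
  has_GDD D K -> has_GDD D K.+1 -> has_holey_design (x * D) n -> has_design (y * D + n) ->
  has_design (K * x * D + y * D + n).
Proof.
move=> yx td gddK gddK1 holey fill.
apply/(has_design_card _ _ (X := (('I_K * 'I_x + 'I_y) * 'I_D + 'I_n)%type)).
  by rewrite card_sum card_prod card_sum card_prod !card_ord mulnDl.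
have card_grp i : #|[pred a : ('I_K * 'I_x + 'I_y) * 'I_D | trunc_grp a.1 == i]| =
    (if i == ord_max then y else x) * D.
  by rewrite (card_preim_fst _ (fun p => trunc_grp p == i)) card_trunc_fiber card_ord.
apply: (decomposable_fill (grp := fun a => trunc_grp a.1) (j0 := ord_max)).
- exact: decomposable_trunc yx td gddK gddK1.
- by move=> i /negbTE ni; rewrite card_grp ni card_ord.
- by rewrite card_grp eqxx card_ord.
Qed.
End Assembly.

(** * Large admissible orders *)

Lemma exists_finField N B : 0 < N -> exists F : finFieldType, B <= #|F| /\ N %| #|F| - 1.
Proof.
move=> N_gt0; have [p p_gt p_pr] := prime_above (N + B).
have totient_gt : 0 < totient N by rewrite totient_gt0.
have [F _ cardF] := pPrimePowerField p_pr totient_gt; exists F; rewrite cardF; split.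
  have p_le : p <= p ^ totient N by rewrite -{1}(expn1 p) leq_exp2l ?prime_gt1.
  by apply: leq_trans p_le; lia.
have p_N : coprime p N.
  by rewrite prime_coprime //; apply/negP => /(dvdn_leq N_gt0); lia.
by rewrite -eqn_mod_dvd ?expn_gt0 ?prime_gt0 // Euler_exp_totient.
Qed.

Lemma exists_finField_expn (F : finFieldType) n : 0 < n ->
  exists F' : finFieldType, #|F'| = #|F| ^ n.
Proof.
move=> n_gt0; have [p p_pr pF] := finPcharP F; have cardF := card_pprimeChar pF.
have log_gt0 : 0 < logn p #|F| * n.
  rewrite muln_gt0 n_gt0 andbT lt0n; apply/eqP => log0.
  by have := finNzRing_gt1 F; rewrite cardF log0.
have [F' _ cardF'] := pPrimePowerField p_pr log_gt0.
by exists F'; rewrite cardF' expnM -cardF.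
Qed.

Lemma eventually_by_residues (P Q : nat -> Prop) N n0 : 0 < N ->
  (forall u, n0 <= u -> P u -> exists V, forall v, V <= v -> P v -> v = u %[mod N] -> Q v) ->
  exists V, forall v, V <= v -> P v -> Q v.
Proof.
move=> N_gt0 evQ.
have /choice [V VP] : forall c, exists V, forall v, V <= v -> P v -> v = c %[mod N] -> Q v.
  move=> c; have [[u [u_ge Pu uc]]|no] := pselect (exists u, [/\ n0 <= u, P u & u = c %[mod N]]).
    by have [V VP] := evQ u u_ge Pu; exists V => v vV Pv vc; apply: VP; rewrite // uc.
  by exists n0 => v v_ge Pv vc; case: no; exists v.
exists (\max_(c < N) V c) => v v_ge Pv; apply: (VP (v %% N)); rewrite ?modn_mod //.
apply: leq_trans v_ge.
exact: (@leq_bigmax _ (fun c : 'I_N => V c) (Ordinal (ltn_pmod v N_gt0))).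
Qed.

Section ColouredWilson.
Variables (k : nat) (C : finType) (col : 'I_k -> 'I_k -> C) (mu : C -> nat) (e l : nat).
Hypotheses (k_gt1 : 1 < k) (col_sym : forall p q, col p q = col q p).
Hypothesis col_occurs : forall c, 0 < #|col_pairs col c|.
Hypotheses (e_gt0 : 0 < e) (l_gt0 : 0 < l).
Hypothesis muE : forall c, e * mu c = l * #|col_pairs col c|.
Local Notation has_GDD := (has_GDD col mu).
Local Notation has_design := (has_design col mu).
Local Notation has_holey_design := (has_holey_design col mu).
Local Notation K := (k + 4).

Definition admissible v :=
  degree_feasible col mu (v - 1) /\ edge_feasible col mu (v * (v - 1)).

Lemma degree_feasible_mul d : degree_feasible col mu (d * e).
Proof.
exists (fun=> d * l) => c.
by rewrite -big_distrr /= sum_pos_degree -!mulnA muE.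
Qed.

Lemma edge_feasible_mul n : edge_feasible col mu (n * e).
Proof. by exists (n * l) => c; rewrite -!mulnA muE. Qed.

Lemma has_GDD_field m s : K <= m -> 0 < s ->
  degree_feasible col mu ((m - 1) * s) -> edge_feasible col mu (m * s * ((m - 1) * s)) ->
  exists q0, forall F : finFieldType, q0 <= #|F| -> forall n, m * s < n ->
    has_GDD (s * #|F| ^ n) m.
Proof.
move=> m_ge s_gt0 deg_ok edge_ok.
have [q0 q0P] := decomposable_multipartite k_gt1 m_ge s_gt0 col_sym col_occurs e_gt0 l_gt0 muE
  deg_ok edge_ok.
exists (q0 + (m * s).+1) => F F_ge n n_gt; apply: has_GDD_blowup => //.
  by apply: leq_trans F_ge; rewrite leq_addl.
by apply: q0P; apply: leq_trans F_ge; rewrite leq_addr.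
Qed.

Lemma exists_design_congruent u N : admissible u -> K <= u -> 0 < N ->
  exists w, [/\ has_design w, u <= w & w = u %[mod N]].
Proof.
move=> [deg_ok edge_ok] u_ge N_gt0.
have [||q0 q0P] := has_GDD_field u_ge (ltn0Sn 0); rewrite ?muln1 //.
have [q1 q1P] := has_design_field col_sym e_gt0 muE.
have M_gt0 : 0 < N * (2 * e) by rewrite !muln_gt0 N_gt0.
have [F [F_ge F_mod]] := exists_finField (q0 + q1) M_gt0.
have [F' cardF'] := exists_finField_expn F (ltn0Sn u).
have F_gt0 := ltnW (finNzRing_gt1 F); have F'_gt0 := ltnW (finNzRing_gt1 F').
have F'_mod : N * (2 * e) %| #|F'| - 1.
  by apply: dvdn_trans F_mod _; rewrite cardF' !subn1 dvdn_pred_predX.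
have F'_design : has_design #|F'|.
  apply: q1P; last by apply: dvdn_trans F'_mod; apply: dvdn_mull.
  apply: (@leq_trans #|F|); first by apply: leq_trans F_ge; rewrite leq_addl.
  by rewrite cardF' -{1}(expn1 #|F|) leq_pexp2l.
have F'_gdd : has_GDD #|F'| u.
  have := q0P F _ u.+1; rewrite mul1n muln1 cardF'; apply=> //.
  by apply: leq_trans F_ge; rewrite leq_addr.
exists (u * #|F'|); split; last 1 first.
- have F'_1 : #|F'| = 1 %[mod N].
    by apply/eqP; rewrite eqn_mod_dvd //; apply: dvdn_trans F'_mod; apply: dvdn_mulr.
  by rewrite -modnMmr F'_1 modnMmr muln1.
- rewrite -[_ * _]addn0; apply: has_design_fill_groups; rewrite ?addn0 //; lia.
- by rewrite leq_pmulr.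
Qed.

Lemma exists_GDD_interval L : exists2 g, 0 < g & forall m, K <= m <= L -> has_GDD g m.
Proof.
have /choice [qf qfP] : forall m, exists q0, K <= m -> forall F : finFieldType, q0 <= #|F| ->
    forall n, m * e < n -> has_GDD (e * #|F| ^ n) m.
  move=> m; have [m_ge|_] := leqP K m; last by exists 0.
  have [||q0 q0P] := has_GDD_field m_ge e_gt0.
  - exact: degree_feasible_mul.
  - by rewrite mulnA; apply: edge_feasible_mul.
  by exists q0.
have [F [F_ge _]] := exists_finField (\max_(m < L.+1) qf m) (ltn0Sn 0).
exists (e * #|F| ^ (L * e).+1).
  by rewrite muln_gt0 e_gt0 expn_gt0 (ltnW (finNzRing_gt1 F)).
move=> m /andP[m_ge m_le]; apply: qfP => //; last by rewrite ltnS leq_mul2r m_le orbT.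
apply: leq_trans F_ge.
exact: (@leq_bigmax _ (fun m : 'I_L.+1 => qf m) (Ordinal (m_le : m < L.+1))).
Qed.

Lemma exists_modulus : exists D, [/\ 0 < D, forall m, K <= m -> has_GDD D m
  & forall m, K <= m -> has_design (m * D + 1)].
Proof.
pose L := 2 * K + 2 * K * (K * (K.+1)`!).
have [g g_gt0 g_gdd] := exists_GDD_interval L.
have [q1 q1P] := has_design_field col_sym e_gt0 muE.
have M_gt0 : 0 < g * L`! ^ L * (2 * e) by rewrite !muln_gt0 g_gt0 expn_gt0 fact_gt0.
have [F [F_ge F_mod]] := exists_finField q1 M_gt0; have F_gt1 := finNzRing_gt1 F.
have /dvdnP [x xE] : g %| #|F| - 1 by apply: dvdn_trans F_mod; rewrite -!mulnA dvdn_mulr.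
have x_gt0 : 0 < x by move: F_gt1; rewrite -subn_gt0 xE muln_gt0 => /andP[].
have fact_x : L`! ^ L %| x.
  by rewrite -(dvdn_pmul2l g_gt0) [g * x]mulnC -xE; apply: dvdn_trans F_mod; apply: dvdn_mulr.
have fill : has_design (x * g + 1).
  rewrite -xE subnK; last exact: ltnW.
  by apply: q1P => //; apply: dvdn_trans F_mod; apply: dvdn_mull.
have gdd m : K <= m -> has_GDD (x * g) m.
  move: m; apply: has_GDD_of_interval => [|m /andP[m_ge m_le]]; first by rewrite addnC.
  apply: has_GDD_weight; first exact: has_TD_leq m_le (has_TD_fact_dvd x_gt0 fact_x).
  by apply: g_gdd; rewrite m_ge.
exists (x * g); split=> [|//|m m_ge]; first by rewrite muln_gt0 x_gt0.
by apply: has_design_fill_groups => //; [lia | apply: gdd].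
Qed.

Section Modulus.
Variable D : nat.
Hypotheses (D_gt0 : 0 < D) (gdd_D : forall m, K <= m -> has_GDD D m).
Hypothesis design_D : forall m, K <= m -> has_design (m * D + 1).

(* The first factor makes [m D + 1] coprime to [w`!] for multiples [m], the second one
   yields transversal designs with [K + 1] groups. *)
Definition class_factor w := w`! * (K.+1)`! ^ K.+1.
Definition class_modulus w := K * (w * D * class_factor w).

Lemma class_factor_gt0 w : 0 < class_factor w.
Proof. by rewrite muln_gt0 expn_gt0 !fact_gt0. Qed.

Lemma class_modulus_gt0 w : 0 < w -> 0 < class_modulus w.
Proof. by move=> w_gt0; rewrite !(muln_gt0, w_gt0, D_gt0, class_factor_gt0) addn_gt0 orbT. Qed.

Lemma has_holey_design_multiple w m : 1 < w -> has_design w -> K <= m -> class_factor w %| m ->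
  has_holey_design (w * m * D) w.
Proof.
move=> w_gt1 w_design m_ge m_dvd.
have -> : w * m * D = w * (m * D + 1) - w by rewrite mulnDr muln1 mulnA addnK.
apply: has_holey_design_TD => //; last exact: design_D.
  by rewrite addn1.
apply: has_TD_coprime; first by rewrite addn1.
have /dvdnP [z ->] : w`! %| m by apply: dvdn_trans m_dvd; apply: dvdn_mulr.
by rewrite coprime_sym mulnAC /coprime gcdnMDl gcdn1.
Qed.

(* [v = K (w m) D + s] with [s = y D + w]: [K] groups of size [w m D] are filled with
   holey designs of hole size [w], and a last group of size [y D] with a design on [s]
   points. *)
Lemma eventually_has_design_congruent w s :
  1 < w -> has_design w -> has_design s -> w <= s -> s = w %[mod D] ->
  exists V, forall v, V <= v -> v = s %[mod class_modulus w] -> has_design v.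
Proof.
move=> w_gt1 w_design s_design ws sw; set E := class_modulus w.
have E_gt0 : 0 < E := class_modulus_gt0 (ltnW w_gt1).
have /dvdnP [y yE] : D %| s - w by rewrite -eqn_mod_dvd // sw.
exists (s + E * (K + s)) => v v_ge vs.
have sv : s <= v by apply: leq_trans v_ge; rewrite leq_addr.
have /dvdnP [t tE] : E %| v - s by rewrite -eqn_mod_dvd // vs.
have t_ge : K + s <= t by rewrite -(leq_pmul2r E_gt0) -tE mulnC leq_subRL.
pose m := class_factor w * t; have m_ge : t <= m by rewrite leq_pmull // class_factor_gt0.
have y_le : y <= w * m.
  have ym : y <= m.
    apply: leq_trans m_ge; apply: leq_trans t_ge; rewrite -[y]add0n leq_add //.
    by apply: leq_trans (leq_subr w s); rewrite yE leq_pmulr.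
  by apply: leq_trans ym _; rewrite leq_pmull // ltnW.
have Km : K <= m by apply: leq_trans m_ge; apply: leq_trans t_ge; rewrite leq_addr.
have td : has_TD K.+1 (w * m).
  apply: has_TD_fact_dvd; first by rewrite muln_gt0 (ltnW w_gt1); lia.
  by rewrite /m; apply: dvdn_mull; rewrite /class_factor -mulnA mulnCA dvdn_mulr.
have fill : has_design (y * D + w) by rewrite -yE subnK.
have holey : has_holey_design (w * m * D) w.
  by apply: has_holey_design_multiple => //; apply: dvdn_mulr.
have := has_design_assemble y_le td (gdd_D (leqnn K)) (gdd_D (leqnSn K)) holey fill.
have -> // : K * (w * m) * D + y * D + w = v.
by rewrite -addnA -yE subnK // -(subnK sv) tE /E /class_modulus /m; congr (_ + s); ring.
Qed.

Lemma eventually_has_design_class w : 1 < w -> has_design w ->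
  exists V, forall v, V <= v -> admissible v -> v = w %[mod D] -> has_design v.
Proof.
move=> w_gt1 w_design; have E_gt0 := class_modulus_gt0 (ltnW w_gt1).
have D_E : D %| class_modulus w by rewrite dvdn_mull // dvdn_mulr // dvdn_mull.
have [u u_ge [u_adm uw]|V VP] := @eventually_by_residues
    (fun v => admissible v /\ v = w %[mod D]) has_design _ (K + w) E_gt0; last first.
  by exists V => v v_ge v_adm vw; apply: VP.
have [s [s_design us su]] := exists_design_congruent u_adm (leq_trans (leq_addr _ _) u_ge) E_gt0.
have sw : s = w %[mod D] by rewrite -uw -(modn_dvdm s D_E) su modn_dvdm.
have ws : w <= s by apply: leq_trans us; apply: leq_trans u_ge; rewrite leq_addl.
have [V VP] := eventually_has_design_congruent w_gt1 w_design s_design ws sw.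
by exists V => v v_ge _ vu; apply: VP; rewrite // su.
Qed.
End Modulus.

Lemma eventually_has_design : exists v0, forall v, v0 <= v -> admissible v -> has_design v.
Proof.
have [D [D_gt0 gdd_D design_D]] := exists_modulus.
apply: (eventually_by_residues D_gt0 (n0 := K)) => u u_ge u_adm.
have [w [w_design uw wu]] := exists_design_congruent u_adm u_ge D_gt0.
have w_gt1 : 1 < w by apply: leq_trans uw; apply: leq_trans u_ge; rewrite addnC.
have [V VP] := eventually_has_design_class D_gt0 gdd_D design_D w_gt1 w_design.
by exists V => v v_ge v_adm vu; apply: VP; rewrite // wu.
Qed.
End ColouredWilson.

(** * Nestings *)

Lemma card_lt_ord (m n : nat) : m <= n -> #|[pred p : 'I_n | p < m]| = m.
Proof. by move=> mn; rewrite -sum1_card (big_ord_narrow mn) sum1_card card_ord. Qed.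

Lemma mem_imset_pair (T X : finType) (b : T -> X) (S : {set T}) (x y : X) :
  injective b -> x != y -> (x \in b @: S) && (y \in b @: S) =
  \sum_(p : T * T | (p.1 != p.2) && ((p.1 \in S) && (p.2 \in S)))
    ((b p.1 == x) && (b p.2 == y)) :> nat.
Proof.
move=> b_inj nxy; have [/andP[/imsetP[p pS xp] /imsetP[q qS yq]]|out] := boolP (_ && _).
  rewrite (bigD1 (p, q)) /=; last first.
    by rewrite pS qS !andbT; apply: contraNneq nxy => pq; rewrite xp yq pq.
  rewrite -xp -yq !eqxx big1 // => -[p' q'] /andP[_ /=].
  by rewrite xp yq !(inj_eq b_inj) xpair_eqE => /negbTE ->.
rewrite big1 // => -[p q] /and3P[/= _ pS qS]; apply/eqP; rewrite eqb0.
by apply: contra out => /andP[/eqP <- /eqP <-]; rewrite !imset_f.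
Qed.

(* The two colours separate the pairs inside the first [k1] positions, to be covered
   [lambda1] times, from the other ones. *)
Definition nest_col (k1 k2 : nat) (p q : 'I_k2) := (p < k1) && (q < k1).
Definition nest_mu (lambda1 lambda2 : nat) (c : bool) := if c then lambda1 else lambda2 - lambda1.

Section Nesting.
Variables (k1 k2 lambda1 lambda2 : nat).
Local Notation col := (@nest_col k1 k2).
Local Notation mu := (nest_mu lambda1 lambda2).

Lemma nest_col_sym p q : col p q = col q p. Proof. exact: andbC. Qed.

Lemma pos_degree_nest_total p : pos_degree col true p + pos_degree col false p = k2 - 1.
Proof.
rewrite subn1 -[k2 in RHS]card_ord -(cardC1 p) -(cardID [pred q | col p q] (predC1 p)).
by congr (_ + _); apply: eq_card => q; rewrite !inE ?eqb_id ?eqbF_neg // andbC.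
Qed.

Hypotheses (k1_gt1 : 1 < k1) (k12 : k1 < k2).

Lemma pos_degree_nest_true p : pos_degree col true p = if p < k1 then k1 - 1 else 0.
Proof.
case: ifP => pk; last by apply: eq_card0 => q; rewrite !inE /nest_col pk andbF.
have := cardD1 p [pred q : 'I_k2 | q < k1]; rewrite card_lt_ord 1?ltnW // inE pk => card_k1.
rewrite [in RHS]card_k1 addKn; apply: eq_card => q.
by rewrite !inE /nest_col pk eqb_id.
Qed.

Lemma card_nest_pairs_true : #|col_pairs col true| = k1 * (k1 - 1).
Proof.
rewrite -sum_pos_degree; under eq_bigr do rewrite pos_degree_nest_true.
by rewrite -big_mkcond sum_nat_const card_lt_ord 1?ltnW.
Qed.

Lemma card_nest_pairs_total : #|col_pairs col true| + #|col_pairs col false| = k2 * (k2 - 1).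
Proof.
rewrite -!sum_pos_degree -big_split /=; under eq_bigr do rewrite pos_degree_nest_total.
by rewrite sum_nat_const card_ord.
Qed.

Lemma nest_pairs_ltn : k1 * (k1 - 1) < k2 * (k2 - 1).
Proof. by nia. Qed.

Lemma nest_col_occurs c : 0 < #|col_pairs col c|.
Proof.
case: c; first by rewrite card_nest_pairs_true muln_gt0; lia.
have := nest_pairs_ltn; rewrite -card_nest_pairs_total card_nest_pairs_true.
by rewrite -[ltnLHS]addn0 ltn_add2l.
Qed.

Hypothesis lambda_eq : lambda1 * (k2 * (k2 - 1)) = lambda2 * (k1 * (k1 - 1)).

Lemma nest_lambda_le : lambda1 <= lambda2.
Proof.
have pairs_gt0 : 0 < k1 * (k1 - 1) by rewrite muln_gt0; lia.
by rewrite -(leq_pmul2r pairs_gt0) -lambda_eq leq_mul2l (ltnW nest_pairs_ltn) orbT.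
Qed.

Lemma nest_muE c : k1 * (k1 - 1) * mu c = lambda1 * #|col_pairs col c|.
Proof.
case: c; first by rewrite card_nest_pairs_true mulnC.
have -> : #|col_pairs col false| = k2 * (k2 - 1) - k1 * (k1 - 1).
  by rewrite -card_nest_pairs_total card_nest_pairs_true addKn.
by rewrite /= mulnC mulnBl [in RHS]mulnBr lambda_eq.
Qed.

(* In a nesting with point degrees [d], every point lies in [t1] inner blocks and [t2]
   outer blocks: let it occupy the first position in [t1] blocks and the last one in the
   other [t2 - t1]. *)
Lemma nest_degree_feasible d : k1 - 1 %| lambda1 * d -> k2 - 1 %| lambda2 * d ->
  degree_feasible col mu d.
Proof.
move=> /dvdnP [t1 t1E] /dvdnP [t2 t2E].
have t1_t2 : t1 * k2 = t2 * k1.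
  have k_gt0 : 0 < (k1 - 1) * (k2 - 1) by rewrite muln_gt0; lia.
  apply/eqP; rewrite -(eqn_pmul2r k_gt0); apply/eqP.
  have -> : t1 * k2 * ((k1 - 1) * (k2 - 1)) = t1 * (k1 - 1) * (k2 * (k2 - 1)) by ring.
  have -> : t2 * k1 * ((k1 - 1) * (k2 - 1)) = t2 * (k2 - 1) * (k1 * (k1 - 1)) by ring.
  by rewrite -t1E -t2E mulnAC lambda_eq; ring.
have t1_le : t1 <= t2 by nia.
have k2_gt0 : 0 < k2 by lia.
have last_lt : k2.-1 < k2 by lia.
pose p0 := Ordinal k2_gt0; pose p1 := Ordinal last_lt.
exists (fun p => (p == p0) * t1 + (p == p1) * (t2 - t1)) => c.
have sum_at q t (g : 'I_k2 -> nat) : \sum_p (p == q) * t * g p = t * g q.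
  by rewrite (bigD1 q) //= eqxx mul1n big1 ?addn0 // => p /negbTE ->.
under eq_bigr do rewrite mulnDl.
rewrite big_split /= !sum_at.
have in0 : (p0 < k1) = true by apply: ltnW.
have out1 : (p1 < k1) = false by apply: negbTE; rewrite -leqNgt /=; lia.
have := pos_degree_nest_total p0; have := pos_degree_nest_total p1.
rewrite !pos_degree_nest_true in0 out1 add0n => outer1 outer0.
case: c; first by rewrite !pos_degree_nest_true in0 out1 muln0 addn0 -t1E mulnC.
have -> : pos_degree col false p0 = (k2 - 1) - (k1 - 1) by rewrite -outer0 addKn.
rewrite outer1 [t1 * _]mulnBr mulnBl [d * _]mulnBr (mulnC d lambda1) (mulnC d lambda2) t1E t2E.
have inner_le : t1 * (k1 - 1) <= t1 * (k2 - 1) by rewrite leq_mul2l; lia.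
have outer_le : t1 * (k2 - 1) <= t2 * (k2 - 1) by rewrite leq_mul2r t1_le orbT.
by rewrite addnC addnBA // subnK.
Qed.

Lemma nest_edge_feasible n : k1 * (k1 - 1) %| lambda1 * n -> edge_feasible col mu n.
Proof.
move=> /dvdnP [N NE]; exists N => c.
have pairs_gt0 : 0 < k1 * (k1 - 1) by rewrite muln_gt0; lia.
apply/eqP; rewrite -(eqn_pmul2l pairs_gt0); apply/eqP.
by rewrite mulnCA nest_muE mulnA [n * _]mulnC NE; ring.
Qed.

Lemma has_nesting_of_design v : has_design col mu v -> has_nesting k2 lambda2 k1 lambda1 v.
Proof.
move=> [I [b bE]].
have b_inj : forall i, injective (b i) by apply: blocks_inj bE => x; rewrite eqxx.
pose inner := [set p : 'I_k2 | p < k1].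
have inner_mult i x y : x != y ->
    (x \in b i @: inner) && (y \in b i @: inner) = edge_mult col (b i) true x y :> nat.
  move=> nxy; rewrite mem_imset_pair //; apply: eq_bigl => p.
  by rewrite !inE eqb_id.
have outer_mult i x y : x != y -> (x \in b i @: setT) && (y \in b i @: setT) =
    edge_mult col (b i) true x y + edge_mult col (b i) false x y :> nat.
  move=> nxy; rewrite mem_imset_pair // (bigID (fun p => col p.1 p.2)) /=.
  by congr (_ + _); apply: eq_bigl => p; rewrite !inE !andbT ?eqb_id ?eqbF_neg.
exists 'I_v, I, (fun i => b i @: setT), (fun i => b i @: inner); split; first split.
- by rewrite card_ord.
- by move=> i; rewrite card_imset // cardsT card_ord.
- move=> x y nxy; rewrite -sum1dep_card big_mkcond.
  transitivity (\sum_i (edge_mult col (b i) true x y + edge_mult col (b i) false x y)).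
    by apply: eq_bigr => i _; rewrite -outer_mult //; case: (_ && _).
  by rewrite big_split /= !bE nxy !muln1 /= subnKC ?nest_lambda_le.
- by move=> i; apply/imsetS/subsetT.
split.
- by rewrite card_ord.
- by move=> i; rewrite card_imset // cardsE card_lt_ord 1?ltnW.
- move=> x y nxy; rewrite -sum1dep_card big_mkcond.
  transitivity (\sum_i edge_mult col (b i) true x y); last by rewrite bE nxy muln1.
  by apply: eq_bigr => i _; rewrite -inner_mult //; case: (_ && _).
Qed.
End Nesting.

Lemma inner_block_size_gt1 (k1 k2 lambda1 lambda2 : nat) : 0 < k1 -> k1 < k2 -> 0 < lambda1 ->
  lambda1 * (k2 * (k2 - 1)) = lambda2 * (k1 * (k1 - 1)) -> 1 < k1.
Proof.
move=> k1_gt0 k12 lambda1_gt0 lambda_eq; rewrite ltnNge; apply/negP => k1_le1.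
have k1E : k1 - 1 = 0 by lia.
by move: lambda_eq; rewrite k1E !muln0 => /eqP; rewrite !muln_eq0; lia.
Qed.

Theorem theorem1p5 (k1 k2 lambda1 lambda2 : nat)
    (k1_gt0 : 0 < k1) (k1_lt_k2 : k1 < k2)
    (lambda1_gt0 : 0 < lambda1) (lambda2_gt0 : 0 < lambda2)
    (lambda_eq : lambda1 * (k2 * (k2 - 1)) = lambda2 * (k1 * (k1 - 1))) :
  exists v0 : nat, forall v : nat, v0 <= v ->
    lambda1 * (v - 1) = 0 %[mod k1 - 1] ->
    lambda1 * (v * (v - 1)) = 0 %[mod k1 * (k1 - 1)] ->
    lambda2 * (v - 1) = 0 %[mod k2 - 1] ->
    has_nesting k2 lambda2 k1 lambda1 v.
Proof.
have k1_gt1 := inner_block_size_gt1 k1_gt0 k1_lt_k2 lambda1_gt0 lambda_eq.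
have k2_gt1 : 1 < k2 := ltn_trans k1_gt1 k1_lt_k2.
have pairs_gt0 : 0 < k1 * (k1 - 1) by rewrite muln_gt0 k1_gt0 subn_gt0.
have [v0 v0P] := eventually_has_design k2_gt1 (@nest_col_sym k1 k2)
  (nest_col_occurs k1_gt1 k1_lt_k2) pairs_gt0 lambda1_gt0
  (nest_muE k1_lt_k2 lambda_eq).
exists v0 => v v_ge; rewrite !mod0n => /eqP inner_deg /eqP inner_edges /eqP outer_deg.
apply: has_nesting_of_design => //; apply: v0P => //; split.
  exact: nest_degree_feasible.
exact: nest_edge_feasible.
Qed.
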